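(* Let $k\ge 1$ be an integer. (1) If $G$ is a co-bipartite graph, then $X_G(x_1,\ldots,x_k)$ is SNP and its Newton polytope is the permutahedron $\mathcal{P}^{(k)}_{\lambda(G)}$. (2) If $d$ is a Dyck path with indifference graph $G(d)$, then $X_{G(d)}(x_1,\ldots,x_k)$ is SNP and its Newton polytope is the permutahedron $\mathcal{P}^{(k)}_{\lambda(d)}$, where $\lambda(d)=\lambda^{\mathrm{gr}}(d)$. (3) If $P$ is a (3+1)-free poset with incomparability graph $G(P)$, then $X_{G(P)}(x_1,\ldots,x_k)$ is SNP and its Newton polytope is the permutahedron $\mathcal{P}^{(k)}_{\lambda(P)}$, where $\lambda(P)=\lambda^{\mathrm{gr}}(P)$.
   Context: All graphs are finite and simple, all posets finite. A coloring $f$ of the vertices of $G$ is proper if adjacent vertices receive different colors. The chromatic symmetric polynomial in $k$ variables is $X_G(x_1,\ldots,x_k)=\sum_f \prod_{v\in V(G)}x_{f(v)}$, summed over all proper colorings $f:V(G)\to[k]=\{1,\dots,k\}$; $X_G$ is the symmetric function in infinitely many variables obtained in the same way with $f:V(G)\to\{1,2,\ldots\}$. The weight of $f$ is $\mathrm{wt}(f)=(|f^{-1}(1)|,|f^{-1}(2)|,\ldots)$. Newton polytopes. For $p=\sum_\alpha c_\alpha \mathbf{x}^\alpha\in\mathbb{R}[x_1,\ldots,x_k]$, $\mathrm{supp}(p)=\{\alpha: c_\alpha\ne0\}$ and $\mathrm{Newton}(p)=\mathrm{conv}(\mathrm{supp}(p))\subset\mathbb{R}^k$. $p$ is SNP (has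 saturated Newton polytope) if $\mathrm{supp}(p)=\mathrm{Newton}(p)\cap\mathbb{Z}^k$. For a partition $\lambda$ with exactly $\ell$ positive parts, if $k\ge \ell$ then $\mathcal{P}^{(k)}_\lambda$ is the convex hull in $\mathbb{R}^k$ of all permutations of $(\lambda_1,\ldots,\lambda_\ell,0,\ldots,0)$; if $k<\ell$ then $\mathcal{P}^{(k)}_\lambda=\emptyset$. Co-bipartite graphs. $G$ is co-bipartite if its complement is bipartite. If $G$ has $n$ vertices, the expansion of $X_G$ in monomial symmetric functions has the form $X_G=\sum_{i=0}^{\lfloor n/2\rfloor}c^G_{2^i1^{n-2i}}m_{2^i1^{n-2i}}$, and $\lambda(G)=2^j1^{n-2j}$ with $j$ maximal such that $c^G_{2^j1^{n-2j}}\neq0$. Dyck paths. A Dyck path $d$ of length $n$ is a lattice path from $(0,0)$ to $(n,n)$ with steps $\mathsf{n}=(0,1)$ and $\mathsf{e}=(1,0)$ not going below $y=x$. Its Hessenberg function $h_d:[n]\to[n]$ is: $h_d(i)$ is the number of unit squares in column $i$ below $d$, i.e. the number of $\mathsf n$ steps preceding the $i$-th $\mathsf e$ step. The indifference graph $G(d)$ has vertex set $[n]$ with an edge between $i<j$ iff $j\le h_d(i)$. The greedy coloring $\mathrm{gr}$ of $G(d)$ processes vertices in the order $1,2,\ldots,n$ and gives each vertex the smallest positive integer not used on its already colored neighbors; $\lambda^{\mathrm{gr}}(d)=\mathrm{wt}(\mathrm{gr})$ (it is a partition of $n$). Posets. A poset is (3+1)-free if there are no chain $a_1<a_2<a_3$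 and element $b$ with $b$ incomparable to $a_1,a_2,a_3$. The incomparability graph $G(P)$ has the elements of $P$ as vertices and edges joining incomparable pairs. Definition of $\lambda^{\mathrm{gr}}(P)$. A part listing is a finite word in the letters $v_i$ ($i\ge0$; a single vertex at level $i$) and $b_{i,i+1}(H)$ ($i\ge0$; $H$ a bicolored graph, i.e. a bipartite graph with a given ordered bipartition, whose lower color class is placed at level $i$ and upper color class at level $i+1$). Its associated poset is on the set of all vertices of all the parts, with $x<y$ iff one of the following holds: (i) $x,y$ are at levels $i,j$ with $j-i\ge2$; (ii) $x$ is exactly one level below $y$ and the part containing $x$ appears strictly before the part containing $y$ in the word; (iii) $x$ is exactly one level below $y$ and they are joined by an edge of a bicolored graph $H$ of the listing. It is known that every (3+1)-free poset is isomorphic to the poset of some part listing, and that the poset of a part listing with no letters $b_{i,i+1}(H)$ has incomparability graph isomorphic to $G(d)$ for some Dyck path $d$. Given a (3+1)-free poset $P$, take a part listing $L$ for $P$. For each part $b_{i,i+1}(H)$ of $L$, with $r$ lower and $s$ upper vertices, let $q_j$ be the probability that $H$ and a uniformly random matching with $\min(r,s)$ edges between lower and upper vertices have exactly $j$ edges in common, let $j$ be the largest index with $q_j\ne0$, and replace the part by the word $v_{i+1}^{s-j}v_i^rv_{i+1}^j$ if $r\ge s$, and by $v_i^jv_{i+1}^sv_i^{r-j}$ if $r<s$. The resulting listing has only letters $v_i$; the incomparability graph of its poset is isomorphic to $G(d)$ for a Dyck path $d$, and $\lambda^{\mathrm{gr}}(P):=\lambda^{\mathrm{gr}}(d)$.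 The statement is asserted for any such choice of $L$ and $d$. *)

(* Defs.v *)
From mathcomp Require Import all_boot all_order all_fingroup all_algebra.
From mathcomp.multinomials Require Import mpoly.
From mathcomp Require Import classical_sets reals.

Set Implicit Arguments.
Unset Strict Implicit.
Unset Printing Implicit Defensive.

Import Order.TTheory GRing.Theory Num.Theory.

Local Open Scope ring_scope.
Local Open Scope classical_set_scope.

(** * Newton polytopes *)

Definition conv (R : realType) (k : nat) (S : set 'rV[R]_k) : set 'rV[R]_k :=
  [set v : 'rV[R]_k | exists (m : nat) (p : 'I_m -> 'rV[R]_k) (w : 'I_m -> R),
     [/\ forall i, S (p i), forall i, 0 <= w i, \sum_(i < m) w i = 1
       & v = \sum_(i < m) w i *: p i]].

(* The support is taken in R^k, so that it can be compared with the polytope. *)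
Definition supp (R : realType) (k : nat) (p : {mpoly R[k]}) : set 'rV[R]_k :=
  [set v : 'rV[R]_k | exists m : 'X_{1..k}, p@_m != 0 /\ v = \row_(i < k) (m i)%:R].

Definition Newton (R : realType) (k : nat) (p : {mpoly R[k]}) : set 'rV[R]_k :=
  conv (supp p).

Definition lattice_points (R : realType) (k : nat) : set 'rV[R]_k :=
  [set v : 'rV[R]_k | forall i, v 0 i \is a Num.int].
Arguments lattice_points : clear implicits.

Definition SNP (R : realType) (k : nat) (p : {mpoly R[k]}) : Prop :=
  supp p = Newton p `&` lattice_points R k.

Definition num_parts (la : seq nat) : nat := count (fun a => 0 < a)%N la.

Definition permutahedron (R : realType) (k : nat) (la : seq nat) :
    set 'rV[R]_k :=
  if (num_parts la <= k)%N
  then conv [set v : 'rV[R]_k |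
               exists s : 'S_k, v = \row_(i < k) (nth 0%N la (s i))%:R]
  else set0.
Arguments permutahedron : clear implicits.

Local Close Scope classical_set_scope.

(** * Graphs and chromatic symmetric polynomials *)

(* A simple graph on V is a symmetric irreflexive relation; the colors
   1, ..., k are the elements of 'I_k. *)
Definition proper_coloring (V : finType) (e : rel V) (k : nat)
    (f : {ffun V -> 'I_k}) : bool :=
  [forall x, forall y, e x y ==> (f x != f y)].

Definition chromatic (R : comNzRingType) (V : finType) (e : rel V) (k : nat) :
    {mpoly R[k]} :=
  \sum_(f : {ffun V -> 'I_k} | proper_coloring e f) \prod_(x : V) 'X_(f x).

Definition bipartite (V : finType) (e : rel V) : Prop :=
  exists A : {set V}, forall x y, e x y -> (x \in A) != (y \in A).

Definition complement (V : finType) (e : rel V) : rel V :=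
  [rel x y | (x != y) && ~~ e x y].

Definition cobipartite (V : finType) (e : rel V) : Prop :=
  bipartite (complement e).

(* The coefficient of m_la in the symmetric function X_G is the coefficient of
   x_1^la_1 ... x_l^la_l, where l is the length of la; this monomial only
   involves the variables x_1, ..., x_l, so it is read off X_G(x_1, ..., x_l). *)
Definition mcoef (V : finType) (e : rel V) (la : seq nat) : int :=
  (chromatic int e (size la))@_[multinom nth 0%N la i | i < size la].

Definition two_one (n j : nat) : seq nat := nseq j 2 ++ nseq (n - j.*2) 1.

(* The default value 0 of the maximum is harmless: for j = 0 the coefficient
   is #|V|!. *)
Definition lambda_cobip (V : finType) (e : rel V) : seq nat :=
  two_one #|V|
    (\max_(j < (#|V|./2).+1 | (mcoef e (two_one #|V| j) != 0)%R) j)%N.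

Definition graph_iso (V W : finType) (e : rel V) (e' : rel W) : Prop :=
  exists2 phi : V -> W, bijective phi & {mono phi : x y / e x y >-> e' x y}.

(** * Dyck paths *)

Inductive step := North | East.

Definition is_north (s : step) : bool := if s is North then true else false.
Definition is_east (s : step) : bool := ~~ is_north s.

Definition dyck_path (n : nat) (d : seq step) : Prop :=
  [/\ count is_north d = n, count is_east d = n
    & forall m, (count is_east (take m d) <= count is_north (take m d))%N].

Definition east_positions (d : seq step) : seq nat :=
  [seq p <- iota 0 (size d) | is_east (nth North d p)].

(* Columns and vertices are numbered from 0: this is h_d(i+1), and vertices
   i < j, which stand for i+1 < j+1, are adjacent iff j+1 <= h_d(i+1). *)
Definition hessenberg (d : seq step) (i : nat) : nat :=
  count is_north (take (nth (size d) (east_positions d) i) d).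

Definition dyck_adj (d : seq step) : rel nat :=
  [rel i j | (i < j < hessenberg d i)%N || (j < i < hessenberg d j)%N].

Definition indifference_graph (n : nat) (d : seq step) : rel 'I_n :=
  [rel i j : 'I_n | dyck_adj d i j].
Arguments indifference_graph : clear implicits.

Definition least_unused (s : seq nat) : nat :=
  (find (fun c => c \notin s) (iota 1 (size s).+1)).+1.

(* The list of the colors (positive integers) of the first n vertices. *)
Fixpoint greedy (d : seq step) (n : nat) : seq nat :=
  if n is m.+1 then
    let c := greedy d m in
    rcons c (least_unused [seq nth 0%N c u | u <- iota 0 m & dyck_adj d u m])
  else [::].

(* The weight of a coloring given by the list of its colors, trailing zeros
   being omitted. *)
Definition weight (c : seq nat) : seq nat :=
  [seq count_mem a c | a <- iota 1 (\max_(a <- c) a)%N].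

Definition lambda_gr (n : nat) (d : seq step) : seq nat := weight (greedy d n).

(** * Posets and part listings *)

Definition three_plus_one_free (disp : Order.disp_t) (P : finPOrderType disp) :
    Prop :=
  ~ exists a1 a2 a3 b : P,
      [/\ (a1 < a2)%O, (a2 < a3)%O, (a1 >< b)%O, (a2 >< b)%O & (a3 >< b)%O].

Definition incomparability_graph (disp : Order.disp_t)
    (P : finPOrderType disp) : rel P :=
  [rel x y : P | (x >< y)%O].
Arguments incomparability_graph {disp} P.

(* [Bicolored i r s H] is b_{i,i+1}(H), with lower class 'I_r at level i and
   upper class 'I_s at level i+1. *)
Inductive part :=
| Single (i : nat)
| Bicolored (i r s : nat) (H : 'I_r -> 'I_s -> bool).

Definition listing := seq part.

Definition part_vertex (p : part) : finType :=
  match p with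
  | Single _ => unit
  | Bicolored _ r s _ => ('I_r + 'I_s)%type
  end.

Definition part_level (p : part) : part_vertex p -> nat :=
  match p with
  | Single i => fun=> i
  | Bicolored i _ _ _ => fun x => if x is inl _ then i else i.+1
  end.

Definition part_edge (p : part) : rel (part_vertex p) :=
  match p with
  | Single _ => fun _ _ => false
  | Bicolored _ _ _ H => fun x y =>
      match x, y with
      | inl a, inr b | inr b, inl a => H a b
      | _, _ => false
      end
  end.

Definition part_at (L : listing) (p : 'I_(size L)) : part := tnth (in_tuple L) p.

(* A vertex is a position in the word together with a vertex of the part at
   that position. *)
Definition listing_vertex (L : listing) : finType :=
  {p : 'I_(size L) & part_vertex (part_at p)}.

Definition level (L : listing) (x : listing_vertex L) : nat :=
  part_level (tagged x).

Definition listing_lt (L : listing) : rel (listing_vertex L) :=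
  [rel x y |
    [|| (level x + 2 <= level y)%N,
        (level y == (level x).+1) && (tag x < tag y)%N
      | [&& level y == (level x).+1, tag x == tag y
          & part_edge (tagged x) (tagged_as x y)]]].

Definition listing_incomparability (L : listing) : rel (listing_vertex L) :=
  [rel x y | [&& x != y, ~~ listing_lt x y & ~~ listing_lt y x]].
Arguments listing_incomparability : clear implicits.

Definition is_listing_of (disp : Order.disp_t) (P : finPOrderType disp)
    (L : listing) : Prop :=
  exists2 phi : P -> listing_vertex L,
    bijective phi & {mono phi : x y / (x < y)%O >-> listing_lt x y}.

Definition matching (r s : nat) (M : {set 'I_r * 'I_s}) : bool :=
  [forall u in M, forall v in M, (u != v) ==> (u.1 != v.1) && (u.2 != v.2)].

Definition max_matchings (r s : nat) : {set {set 'I_r * 'I_s}} :=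
  [set M | matching M & #|M| == minn r s].

(* q_j, for the uniform distribution on [max_matchings r s]. *)
Definition matching_prob (r s : nat) (H : 'I_r -> 'I_s -> bool) (j : nat) :
    rat :=
  #|[set M in max_matchings r s | #|[set u in M | H u.1 u.2]| == j]|%:R
  / #|max_matchings r s|%:R.

Definition max_common (r s : nat) (H : 'I_r -> 'I_s -> bool) : nat :=
  (\max_(j < (minn r s).+1 | (matching_prob H j != 0)%R) j)%N.

Definition replace_part (p : part) : listing :=
  match p with
  | Single i => [:: Single i]
  | Bicolored i r s H =>
      let j := max_common H in
      if (s <= r)%N
      then nseq (s - j) (Single i.+1) ++ nseq r (Single i)
             ++ nseq j (Single i.+1)
      else nseq j (Single i) ++ nseq s (Single i.+1)
             ++ nseq (r - j) (Single i)
  end.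

Definition replaced_listing (L : listing) : listing :=
  flatten [seq replace_part p | p <- L].

(* la is a value of lambda^gr(P), for some choice of a part listing L of P and
   of a Dyck path d whose indifference graph is the incomparability graph of
   the listing obtained from L. *)
Definition is_lambda_gr (disp : Order.disp_t) (P : finPOrderType disp)
    (la : seq nat) : Prop :=
  exists (L : listing) (n : nat) (d : seq step),
    [/\ is_listing_of P L, dyck_path n d,
        graph_iso (listing_incomparability (replaced_listing L))
                  (indifference_graph n d)
      & la = lambda_gr n d].

(* Main.v *)
Require Import Defs.
From mathcomp Require Import classical_sets reals.
From mathcomp Require Import all_boot all_order all_fingroup all_algebra.
From mathcomp.multinomials Require Import mpoly.
From mathcomp Require Import zify ring lra.

(* The support of X_G(x_1, ..., x_k) is the set of weights of proper colorings
   with k colors; it is invariant under permutations of the colors. Suppose that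
   it contains a partition la that dominates all its elements, and that whenever
   a color i is used at least twice more than a color j, some proper coloring has
   the same weight except for one unit transferred from i to j. Every vector of
   N^k dominated by la is obtained from la by permutations and such transfers, so
   that the support is the set of lattice points of the permutahedron of la.

   Co-bipartite graphs: color classes have at most two vertices, and transfers
   are trivial. Indifference graphs: transfers exchange two colors on an initial
   segment of the vertices, and the vertices of greedy color at most m form a
   largest m-colorable subgraph. (3+1)-free posets: what a part b_{i,i+1}(H)
   contributes to a proper coloring is a set of colors at level i and one at level
   i+1 with at most as many common colors as a maximum matching of H has edges;
   the word that replaces the part contributes the same pairs of sets, so the
   support is that of an indifference graph. *)

Set Implicit Arguments.
Unset Strict Implicit.
Unset Printing Implicit Defensive.

Import Order.TTheory GRing.Theory Num.Theory.

(** * Dominance and convex hulls *)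

Lemma antitone_leq (a : nat -> nat) :
  (forall i, a i.+1 <= a i) -> forall x y, x <= y -> a y <= a x.
Proof.
move=> da x y /subnKC <-; elim: (y - x) => [|n IHn]; first by rewrite addn0.
by rewrite addnS; apply: leq_trans IHn.
Qed.

Definition psum (a : nat -> nat) (m : nat) : nat := \sum_(i < m) a i.

Lemma psumS (a : nat -> nat) (m : nat) : psum a m.+1 = psum a m + a m.
Proof. by rewrite /psum big_ord_recr. Qed.

(** Exactly the partial sums that contain [i] but not [j] rise by one. The booleans stand on both
    sides to avoid subtraction, and [0 < a j] makes the truncated one exact. *)
Lemma psum_transfer (a : nat -> nat) (i j m : nat) :
  i < j -> 0 < a j ->
  psum (fun x => a x + (x == i) - (x == j)) m + (j < m) = psum a m + (i < m).
Proof.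
move=> ij aj; elim: m => [|m IHm]; first by rewrite /psum !big_ord0.
move: IHm; rewrite !psumS !ltnS.
by case: (ltngtP m i) => ?; case: (ltngtP m j) => ?; subst; lia.
Qed.

(* Upward induction on the dominance order: the first index [i] where the two
   sequences differ and the first later index [j] where their partial sums
   agree again give a transfer from [j] to [i] that stays below [la]. *)
Lemma dominance_transfers (k : nat) (C : (nat -> nat) -> Prop)
    (la al : nat -> nat) :
  (forall a b, a =1 b -> C a -> C b) ->
  (forall a i j, i < k -> j < k -> a j + 2 <= a i -> C a ->
     C (fun x => a x + (x == j) - (x == i))) ->
  (forall i, la i.+1 <= la i) -> (forall i, al i.+1 <= al i) ->
  (forall m, psum al m <= psum la m) -> psum al k = psum la k ->
  (forall i, k <= i -> la i = 0) -> (forall i, k <= i -> al i = 0) ->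
  C la -> C al.
Proof.
move=> Cext Cmove dla.
have [N] := ubnP (\sum_(m < k) (psum la m - psum al m)).
elim: N al => // N IHN al leN dal dom tot lak alk Cla.
have [/forallP E|] := boolP [forall i : 'I_k, al i == la i].
  apply: Cext Cla => i; case: (ltnP i k) => ik; last by rewrite lak ?alk.
  by rewrite (eqP (E (Ordinal ik))).
rewrite negb_forall => /existsP[i0 i0P].
have [|i /andP[ik iP] imin] := @ex_minnP (fun i => (i < k) && (al i != la i)).
  by exists i0; rewrite ltn_ord.
have eq_al x : x < i -> al x = la x.
  by move=> xi; apply/eqP/negPn/negP => xP; have := imin x; rewrite xP; lia.
have eq_psum m : m <= i -> psum al m = psum la m.
  by move=> mi; apply: eq_bigr => -[x /= xm] _; apply: eq_al; lia.
have ali : al i < la i.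
  by have := dom i.+1; rewrite !psumS eq_psum // leq_add2l; lia.
have lti : psum al i.+1 < psum la i.+1 by rewrite !psumS eq_psum //; lia.
have i1k : i.+1 < k.
  case: (ltngtP i.+1 k) => // [|E]; first lia.
  by move: lti; rewrite E tot ltnn.
have [|j /andP[ij /eqP jP] jmin] :=
    @ex_minnP (fun j => (i < j) && (psum al j.+1 == psum la j.+1)).
  by exists k.-1; rewrite prednK ?tot ?eqxx ?andbT; lia.
have lt_psum m : i < m -> m <= j -> psum al m < psum la m.
  move=> im mj; rewrite ltn_neqAle dom andbT; apply/eqP => E.
  have [Em|nm] := eqVneq m i.+1; first by move: lti; rewrite -Em E ltnn.
  have := jmin m.-1; rewrite prednK ?E ?eqxx ?andbT; lia.
have alj : la j < al j by have := lt_psum j ij (leqnn j); move: jP; rewrite !psumS; lia.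
have jk : j < k by rewrite ltnNge; apply/negP => /alk; lia.
(* The partial sums agree up to [j], so [al j.+1 <= la j.+1 <= la j < al j]: the sequence drops
   strictly after [j], and lowering [al j] keeps it decreasing. *)
have := dom j.+2; rewrite !(psumS _ j.+1) jP leq_add2l => alj1.
pose be x := al x + (x == i) - (x == j).
have psum_be m : psum be m + (j < m) = psum al m + (i < m).
  by apply: psum_transfer => //; lia.
have dbe x : be x.+1 <= be x.
  rewrite /be; have := dal x; have := dla j.
  have [E|ne] := eqVneq x.+1 i.
    subst i; have := dla x; rewrite -(eq_al x (ltnSn x)).
    by have := eq_al x (ltnSn x); lia.
  have [E|ne1] := eqVneq x j; first by subst; lia.
  by have [E2|ne2] := eqVneq x i; lia.
have Cbe : C be.
  apply: IHN => // [|m||x xk].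
  - rewrite ltnS in leN; apply: leq_trans leN.
    (* The measure drops at this term: the partial sum of length [i.+1] was below that of [la] and
       rises by one. *)
    rewrite (bigD1 (Ordinal i1k)) // [X in _ < X](bigD1 (Ordinal i1k)) //=.
    rewrite -addSn; apply: leq_add; last apply: leq_sum => -[m mk] /= _.
      by have := psum_be i.+1; lia.
    by have := psum_be m; case: (ltnP i m); case: (ltnP j m); lia.
  - have := psum_be m; have := dom m; have := lt_psum m.
    by case: (ltnP i m); case: (ltnP j m); lia.
  - by have := psum_be k; rewrite tot ik jk; lia.
  - by rewrite /be (alk _ xk); lia.
(* Moving the unit back from [i] to [j] recovers [al]; the required gap of two in [be] comes from
   [al j <= al i]. *)
apply: Cext (Cmove be i j ik jk _ Cbe).
  move=> x; rewrite /be.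
  by have [?|?] := eqVneq x i; have [?|?] := eqVneq x j; subst; lia.
have := antitone_leq dal (ltnW ij); rewrite /be !eqxx; lia.
Qed.

Lemma psum_over (a : nat -> nat) (k m : nat) :
  (forall i, k <= i -> a i = 0) -> k <= m -> psum a m = psum a k.
Proof.
move=> ak /subnKC <-; elim: (m - k) => [|n IHn]; first by rewrite addn0.
by rewrite addnS psumS IHn ak ?addn0 // leq_addr.
Qed.

Lemma sort_perm (k : nat) (a : {ffun 'I_k -> nat}) :
  exists s : 'S_k, forall i j : 'I_k, i <= j -> a (s j) <= a (s i).
Proof.
pose t := [tuple a i | i < k].
have /tuple_permP[s Es] : perm_eq (sort geq t) t by rewrite perm_sort.
exists s => i j ij.
have nthE (l : 'I_k) : nth 0 (sort geq t) l = a (s l).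
  by rewrite Es nth_mktuple tnth_mktuple.
rewrite -!nthE; apply: (@sorted_leq_nth _ geq) => //.
- by move=> x y z /= xy yz; apply: leq_trans yz xy.
- exact: leqnn.
- by apply: sort_sorted => x y; apply: leq_total.
- by rewrite inE size_sort size_tuple.
- by rewrite inE size_sort size_tuple.
Qed.

(** By invariance under permutations, [a] may be sorted decreasingly and extended by zero; its
    partial sums are then sums of [a] over sets of indices. The predicate [C] is arbitrary because
    it will be both membership in the support and membership in the permutahedron. *)
Lemma dominance_closed (k : nat) (C : {ffun 'I_k -> nat} -> Prop)
    (la : nat -> nat) (a : {ffun 'I_k -> nat}) :
  (forall (b : {ffun 'I_k -> nat}) (s : 'S_k), C b -> C [ffun i => b (s i)]) ->
  (forall (b : {ffun 'I_k -> nat}) i j, b j + 2 <= b i -> C b ->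
     C [ffun x => b x + (x == j) - (x == i)]) ->
  (forall i, la i.+1 <= la i) -> (forall i, k <= i -> la i = 0) ->
  \sum_i a i = psum la k ->
  (forall T : {set 'I_k}, \sum_(i in T) a i <= psum la #|T|) ->
  C [ffun i : 'I_k => la i] -> C a.
Proof.
move=> Cperm Cmove dla lak tot dom Cla.
have [s sP] := sort_perm a.
pose a' x := if insub x is Some i then a (s i) else 0.
have a'E (i : 'I_k) : a' i = a (s i) by rewrite /a' valK.
have a'k i : k <= i -> a' i = 0.
  by rewrite /a' => ki; case: insubP => // j; rewrite ltnNge ki.
have psum_a' m : m <= k -> psum a' m = \sum_(i in s @: [set i : 'I_k | i < m]) a i.
  move=> mk; rewrite big_imset /=; last by move=> ? ? _ _; apply: perm_inj.
  under [RHS]eq_bigl do rewrite inE.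
  rewrite /psum (big_ord_widen _ a' mk).
  by apply: eq_bigr => i _; rewrite a'E.
have card_m m : m <= k -> #|s @: [set i : 'I_k | i < m]| = m.
  move=> mk; rewrite card_imset; last exact: perm_inj.
  rewrite -sum1_card; under eq_bigl do rewrite inE.
  by rewrite -(big_ord_widen k (fun=> 1) mk) sum1_card card_ord.
have tot' : psum a' k = psum la k.
  rewrite psum_a' // -tot; apply: eq_bigl => i.
  apply/imsetP; exists (s^-1%g i); last by rewrite permKV.
  by rewrite inE ltn_ord.
have : C [ffun i : 'I_k => a' i].
  apply: (@dominance_transfers k (fun b => C [ffun i : 'I_k => b i]) la) => //.
  - by move=> b b' bb'; congr C; apply/ffunP => i; rewrite !ffunE.
  - move=> b i j ik jk bij Cb.
    have := Cmove _ (Ordinal ik) (Ordinal jk) _ Cb; rewrite !ffunE => /(_ bij).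
    by congr C; apply/ffunP => x; rewrite !ffunE.
  - move=> i; case: (ltnP i.+1 k) => ik; last by rewrite a'k.
    by rewrite (a'E (Ordinal ik)) (a'E (Ordinal (ltnW ik))) sP /=.
  - move=> m; case: (leqP m k) => mk; first by rewrite psum_a' // -{2}(card_m m).
    by rewrite !(@psum_over _ k) ?tot' ?(ltnW mk).
move/(Cperm _ s^-1%g); congr C; apply/ffunP => i.
by rewrite !ffunE a'E permKV.
Qed.

(** * Convex hulls of sets of row vectors *)

Section Convexity.

Context (R : realType) (k : nat).
Local Open Scope ring_scope.
Local Open Scope classical_set_scope.

Definition convex_set (C : set 'rV[R]_k) : Prop :=
  forall x y t, 0 <= t -> t <= 1 -> C x -> C y -> C (t *: x + (1 - t) *: y).

Lemma subset_conv (S : set 'rV[R]_k) : S `<=` conv S.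
Proof.
move=> v Sv; exists 1%N, (fun=> v), (fun=> 1); split => //.
- by rewrite big_ord1.
- by rewrite big_ord1 scale1r.
Qed.

Lemma conv_convex (S : set 'rV[R]_k) : convex_set (conv S).
Proof.
move=> x y t t0 t1 [m [p [w [Sp w0 w1 ->]]]] [m' [p' [w' [Sp' w'0 w'1 ->]]]].
exists (m + m')%N.
exists (fun i => match split i with inl j => p j | inr j => p' j end).
exists (fun i => match split i with inl j => t * w j
                 | inr j => (1 - t) * w' j end).
have sl j : split (lshift m' j) = inl j.
  by rewrite -[lshift _ _]/(unsplit (inl j)) unsplitK.
have sr j : split (rshift m j) = inr j.
  by rewrite -[rshift _ _]/(unsplit (inr j)) unsplitK.
split.
- by move=> i; case: (split i).
- by move=> i; case: (split i) => j; rewrite mulr_ge0 // subr_ge0.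
- rewrite big_split_ord /=.
  under eq_bigr do rewrite sl; under [X in _ + X]eq_bigr do rewrite sr.
  by rewrite -!mulr_sumr w1 w'1; ring.
- rewrite big_split_ord /= !scaler_sumr; congr (_ + _); apply: eq_bigr => j _.
    by rewrite sl scalerA.
  by rewrite sr scalerA.
Qed.

Lemma conv_min (S C : set 'rV[R]_k) : convex_set C -> S `<=` C -> conv S `<=` C.
Proof.
move=> convC SC v [m [p [w [Sp w0 w1 ->]]]].
(* Partial combinations do not have total weight one, so the induction on the number of points
   normalises them, as soon as their total weight is positive. *)
suff H : forall n (nm : (n <= m)%N) (q : 'I_n -> 'rV[R]_k) (u : 'I_n -> R),
    (forall i, S (q i)) -> (forall i, 0 <= u i) -> 0 < \sum_i u i ->
    C ((\sum_i u i)^-1 *: \sum_i u i *: q i).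
  by have := H m (leqnn m) p w Sp w0; rewrite w1 invr1 scale1r; apply.
elim=> [|n IHn] nm q u Sq u0; first by rewrite big_ord0 ltxx.
rewrite !big_ord_recr /=; set s := \sum_(i < n) _; set x := \sum_(i < n) _ *: _.
have s0 : 0 <= s by apply: sumr_ge0.
move=> su.
have [sE|sP] := eqVneq s 0.
  have -> : x = 0.
    apply: big1 => i _; have /eqP := sE.
    rewrite psumr_eq0 // => /allP/(_ i); rewrite mem_index_enum => /(_ isT)/eqP ->.
    by rewrite scale0r.
  rewrite sE !add0r scalerA mulVf ?scale1r; first exact/SC.
  by move: su; rewrite sE add0r => /gt_eqF ->.
have s1 : 0 < s by rewrite lt_neqAle eq_sym sP.
have Cx : C (s^-1 *: x) by apply: (IHn (ltnW nm)).
have -> : (s + u ord_max)^-1 *: (x + u ord_max *: q ord_max) =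
    (s / (s + u ord_max)) *: (s^-1 *: x) + (1 - s / (s + u ord_max)) *: q ord_max.
  rewrite scalerDr !scalerA; congr (_ *: _ + _ *: _); field.
    by rewrite sP gt_eqF.
  by rewrite gt_eqF.
apply: convC => //; last exact/SC.
- by rewrite divr_ge0 // ltW.
- by rewrite ler_pdivrMr // mul1r lerDl.
Qed.

Lemma conv_subset (S S' : set 'rV[R]_k) : S `<=` conv S' -> conv S `<=` conv S'.
Proof. by apply: conv_min; apply: conv_convex. Qed.

Lemma conv0 : conv (@classical_sets.set0 'rV[R]_k) = classical_sets.set0.
Proof. by apply/seteqP; split=> // v; apply: conv_min. Qed.

Lemma convex_col_perm (C : set 'rV[R]_k) (s : 'S_k) :
  convex_set C -> convex_set [set v | C (col_perm s v)].
Proof.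
move=> convC x y t t0 t1 Cx Cy /=.
have -> : col_perm s (t *: x + (1 - t) *: y) =
    t *: col_perm s x + (1 - t) *: col_perm s y by apply/rowP => i; rewrite !mxE.
exact: convC.
Qed.

End Convexity.

(** * Weights of proper colorings *)

(** Colors are plain natural numbers, so that colorings can be modified without regard to [k];
    [is_weight] imposes the bound. *)
Definition nat_coloring (V : finType) (e : rel V) (c : V -> nat) : Prop :=
  forall x y, e x y -> c x <> c y.

Definition class_size (V : finType) (c : V -> nat) (i : nat) : nat :=
  \sum_v (c v == i).

Definition is_weight (V : finType) (e : rel V) (k : nat) (a : 'I_k -> nat) : Prop :=
  exists2 c : V -> nat, nat_coloring e c
    & (forall v, c v < k) /\ (forall i : 'I_k, class_size c i = a i).

Local Open Scope ring_scope.

Lemma mcoeff_chromatic (R : comNzRingType) (V : finType) (e : rel V) (k : nat)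
    (m : 'X_{1..k}) :
  (chromatic R e k)@_m =
  #|[pred f : {ffun V -> 'I_k} | proper_coloring e f
      & [forall i : 'I_k, class_size (fun v => f v) i == m i]]|%:R.
Proof.
rewrite /chromatic (raddf_sum (mcoeff m)) -sum1_card natr_sum /=.
rewrite [RHS](eq_bigl (fun f : {ffun V -> 'I_k} => proper_coloring e f &&
  [forall i : 'I_k, class_size (fun v => f v) i == m i])) //.
rewrite big_mkcondr; apply: eq_bigr => f _.
rewrite -(big_morph _ (@mpolyXD k R) (mpolyX0 k R)) mcoeffX.
have -> : (\sum_v U_(f v))%MM == m =
    [forall i : 'I_k, class_size (fun v => f v) i == m i].
  apply/eqP/forallP => [<- i|H].
    rewrite mnm_sumE; apply/eqP/eq_bigr => v _.
    by rewrite mnm1E.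
  apply/mnmP => i; rewrite mnm_sumE -(eqP (H i)).
  by apply/eq_bigr => v _; rewrite mnm1E.
by case: ifP.
Qed.

(** Coefficients count colorings, so nothing cancels in characteristic zero. The ring is left
    general because the lemma serves over the reals for supports and over [int] for [mcoef]. *)
Lemma mcoeff_chromatic_neq0 (R : comNzRingType) (V : finType) (e : rel V) (k : nat)
    (m : 'X_{1..k}) : (forall n : nat, (n%:R == 0 :> R) = (n == 0)%N) ->
  (chromatic R e k)@_m != 0 <-> is_weight e m.
Proof.
move=> char0; rewrite mcoeff_chromatic char0 -lt0n; split.
  case/card_gt0P => f /andP[/= /'forall_forallP pf /forallP wf].
  exists (fun v => f v : nat); last by split=> // i; apply/eqP/wf.
  move=> x y exy E; have := pf x y; rewrite exy /= => /eqP; apply.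
  exact: val_inj.
case=> c pc [ck wc].
apply/card_gt0P; exists [ffun v => Ordinal (ck v)]; apply/andP; split.
  apply/'forall_forallP => x y; apply/implyP => exy; rewrite !ffunE.
  by apply/eqP => -[]; apply: pc.
apply/forallP => i; rewrite -wc; apply/eqP/eq_bigr => v _; by rewrite ffunE.
Qed.

Lemma supp_chromatic (R : realType) (V : finType) (e : rel V) (k : nat) (v : 'rV[R]_k) :
  supp (chromatic R e k) v <->
  exists a : 'I_k -> nat, is_weight e a /\ v = \row_i (a i)%:R.
Proof.
split=> [[m [/mcoeff_chromatic_neq0 mP ->]]|[a [aP ->]]].
  by exists m; split => //; apply: mP => n; rewrite pnatr_eq0.
exists [multinom a i | i < k]; split.
  apply/mcoeff_chromatic_neq0 => [n|]; first by rewrite pnatr_eq0.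
  by case: aP => c pc [ck wc]; exists c => //; split=> // i; rewrite mnmE.
by apply/rowP => i; rewrite !mxE mnmE.
Qed.

(** * Class sizes, and a criterion for the Newton polytope to be a permutahedron *)

Lemma class_size_sum (V : finType) (c : V -> nat) (T : seq nat) :
  uniq T -> (\sum_(i <- T) class_size c i = \sum_v (c v \in T))%N.
Proof.
move=> uT; rewrite exchange_big; apply: eq_bigr => v _ /=.
rewrite -(count_uniq_mem _ uT) -sum1_count -big_mkcondr /=.
by rewrite sum1_count sum1_count; apply: eq_count => i /=; rewrite eq_sym.
Qed.

(** The positive entries of a decreasing sequence form a prefix. This decides which case of
    [permutahedron] applies. *)
Lemma num_parts_le (la : seq nat) (k : nat) :
  (forall i, nth 0%N la i.+1 <= nth 0%N la i)%N ->
  (num_parts la <= k)%N = (nth 0%N la k == 0%N).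
Proof.
move=> dla.
have mono := antitone_leq dla.
rewrite /num_parts; apply/idP/eqP => [|lak].
  case: (posnP (nth 0%N la k)) => // lak; rewrite leqNgt.
  have ks : (k < size la)%N by rewrite ltnNge; apply/negP => /(nth_default 0%N); lia.
  rewrite -(cat_take_drop k.+1 la) count_cat.
  have /eqP -> : count (fun a => 0 < a)%N (take k.+1 la) == size (take k.+1 la).
    rewrite -all_count; apply/(all_nthP 0%N) => i; rewrite size_takel // => ik.
  by rewrite nth_take //; apply: leq_trans lak (mono _ _ _).
  by rewrite size_takel // ltn_addr.
rewrite -(cat_take_drop k la) count_cat.
have /eqP -> : count (fun a => 0 < a)%N (drop k la) == 0%N.
  rewrite -leqn0 leqNgt -has_count; apply/(has_nthP 0%N) => -[i _].
  by rewrite nth_drop; have := mono k (k + i)%N (leq_addr _ _); lia.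
by rewrite addn0; apply: leq_trans (count_size _ _) _; rewrite size_take; case: ltnP.
Qed.

Lemma psum_class_size (V : finType) (c : V -> nat) (k : nat) :
  (forall v, (c v < k)%N) -> psum (class_size c) k = #|V|.
Proof.
move=> ck; rewrite /psum -(big_mkord predT (class_size c)) class_size_sum ?iota_uniq //.
by under eq_bigr do rewrite mem_iota add0n subn0 ck; rewrite sum1_card.
Qed.

Lemma class_size0 (V : finType) (c : V -> nat) (k : nat) :
  (forall v, (c v < k)%N) <-> (forall i, (k <= i)%N -> class_size c i = 0%N).
Proof.
split=> [ck i ki|H v].
  by apply: big1 => v _; rewrite ltn_eqF // (leq_trans (ck v)).
rewrite ltnNge; apply/negP => /H /eqP; rewrite sum_nat_eq0 => /forallP/(_ v).
by rewrite eqxx.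
Qed.

Lemma is_weight_perm (V : finType) (e : rel V) (k : nat) (a : 'I_k -> nat) (s : 'S_k) :
  is_weight e a -> is_weight e (fun i => a (s i)).
Proof.
case=> c pc [ck wc].
exists (fun v => (s^-1)%g (Ordinal (ck v)) : nat).
  by move=> x y /pc E /val_inj/perm_inj[].
split=> [//|i]; rewrite -wc; apply: eq_bigr => v _.
by rewrite val_eqE -(inj_eq (@perm_inj _ s)) permKV.
Qed.

(** By [dominance_closed], every vector dominated by [la] is a weight, and also lies in the hull of
    the permutations of [la]. Conversely weights are dominated by [la], and so are the lattice
    points of their hull, dominance being given by linear inequalities. The hypotheses do not
    mention [k], so one verification serves for all [k]. *)
Lemma permutahedral_chromatic (R : realType) (k : nat) (V : finType) (e : rel V)
    (la : seq nat) :
  (exists2 c, nat_coloring e c & forall i, class_size c i = nth 0%N la i) ->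
  (forall c T, nat_coloring e c -> uniq T ->
     (\sum_v (c v \in T) <= psum (nth 0%N la) (size T))%N) ->
  (forall c i j, nat_coloring e c -> (class_size c j + 2 <= class_size c i)%N ->
     exists2 c', nat_coloring e c' &
       forall x, (class_size c' x = class_size c x + (x == j) - (x == i))%N) ->
  SNP (chromatic R e k) /\ Newton (chromatic R e k) = permutahedron R k la.
Proof.
move=> [c0 pc0 wc0] dom move_.
have dla i : (nth 0 la i.+1 <= nth 0 la i)%N.
  (* Dominance for the colors below [i] together with [i.+1], compared with the first [i.+1] parts,
     shows that [la] is decreasing. *)
  have := dom c0 (i.+1 :: iota 0 i) pc0.
  rewrite /= mem_iota iota_uniq ltnNge leqnSn andbF /= => /(_ isT).
  rewrite -class_size_sum /= ?mem_iota ?iota_uniq ?ltnNge ?leqnSn ?andbF //.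
  rewrite big_cons size_iota psumS addnC wc0 -[X in iota 0 X]subn0.
  rewrite big_mkord /psum; under eq_bigr do rewrite wc0.
  by rewrite leq_add2l.
rewrite /permutahedron; case: ifP => [|/negbT]; rewrite num_parts_le // => lak.
- have la0 i : (k <= i)%N -> nth 0%N la i = 0%N.
    by move=> /(antitone_leq dla); rewrite (eqP lak); lia.
  have tot (c : V -> nat) : (forall v, c v < k)%N ->
      psum (class_size c) k = psum (nth 0%N la) k.
    move=> ck; rewrite psum_class_size // -(@psum_class_size V c0 k).
      by apply: eq_bigr => i _; rewrite wc0.
    by apply/class_size0 => i /la0; rewrite wc0.
  pose O := [set v : 'rV[R]_k |
               exists s : 'S_k, v = \row_(i < k) (nth 0%N la (s i))%:R]%classic.
  pose domi (a : 'I_k -> nat) := (\sum_i a i = psum (nth 0 la) k)%N /\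
    (forall T : {set 'I_k}, (\sum_(i in T) a i <= psum (nth 0 la) #|T|)%N).
  have weight_la : is_weight e (fun i : 'I_k => nth 0%N la i).
    exists c0 => //; split=> [|i]; last by rewrite wc0.
    by apply/class_size0 => i /la0; rewrite wc0.
  have ext (a b : 'I_k -> nat) :
      is_weight e a -> a =1 b -> is_weight e b.
    by move=> [c pc [ck wc]] ab; exists c => //; split=> // i; rewrite wc.
  have domi_weight (a : 'I_k -> nat) : domi a -> is_weight e a.
    move=> [a1 a2]; apply: (ext (finfun a)); last by move=> i; rewrite ffunE.
    apply: (@dominance_closed k (fun a => is_weight e a) (nth 0%N la)) => //.
    + move=> b s /(is_weight_perm s) Cb; apply: (ext _ _ Cb) => i.
      by rewrite ffunE.
    + move=> b i j bij [c pc [ck wc]].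
      have [|c' pc' wc'] := move_ c i j pc; first by rewrite !wc.
      exists c' => //; split=> [|x]; last by rewrite ffunE wc' wc.
      apply/class_size0 => x xk; rewrite wc'.
      have /class_size0 -> // := ck; have := ltn_ord j.
      by case: (ltngtP x j); lia.
    + by rewrite -a1; apply: eq_bigr => i _; rewrite ffunE.
    + by move=> T; under eq_bigr do rewrite ffunE; apply: a2.
    + by apply: (ext _ _ weight_la) => i; rewrite ffunE.
  have Operm (s : 'S_k) v : conv O v -> conv O (col_perm s v).
    apply: (conv_min (C := [set v | conv O (col_perm s v)]%classic)).
      by apply: convex_col_perm; apply: conv_convex.
    move=> _ [s' ->]; apply: subset_conv; exists (s * s')%g.
    by apply/rowP => i; rewrite !mxE permM.
  have domi_conv (a : 'I_k -> nat) : domi a -> conv O (\row_i (a i)%:R).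
    move=> [a1 a2].
    have -> : \row_i (a i)%:R = \row_i (finfun a i)%:R :> 'rV[R]_k.
      by apply/rowP => i; rewrite !mxE ffunE.
    apply: (@dominance_closed k (fun a => conv O (\row_i (a i)%:R)) (nth 0%N la)) => //.
    + move=> b s /(Operm s); congr (conv O _); apply/rowP => i.
      by rewrite !mxE ffunE.
    + move=> b i j bij Cb.
      have bij0 : 0 < (b i)%:R - (b j)%:R :> R.
        by rewrite subr_gt0 ltr_nat; lia.
      (* With weight [t] on the vector [b] with entries [i] and [j] exchanged and [1 - t] on [b],
         the combination moves exactly one unit from [i] to [j]. *)
      pose t : R := ((b i)%:R - (b j)%:R)^-1.
      have t1 : t <= 1.
        rewrite invf_le1 // -natrB ?ler1n; lia.
      have := @conv_convex R k O _ _ t _ t1 (Operm (tperm i j) _ Cb) Cb.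
      rewrite invr_ge0 ltW // => /(_ isT); congr (conv O _).
      apply/rowP => x; rewrite !mxE ffunE.
      have ij : i != j by apply/eqP => E; move: bij; rewrite E; lia.
      have [->|xi] := eqVneq x i.
        rewrite tpermL (negPf ij) addn0 natrB /=; last lia.
        by rewrite /t; field; rewrite gt_eqF.
      have [->|xj] := eqVneq x j.
        rewrite tpermR subn0 natrD /=.
        by rewrite /t; field; rewrite gt_eqF.
      by rewrite tpermD 1?eq_sym // addn0 subn0; ring.
    + by rewrite -a1; apply: eq_bigr => i _; rewrite ffunE.
    + by move=> T; under eq_bigr do rewrite ffunE; apply: a2.
    + apply: subset_conv; exists 1%g; apply/rowP => i.
      by rewrite !mxE ffunE perm1.
  have weight_domi a : is_weight e a -> domi a.
    move=> [c pc [ck wc]]; split.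
      by rewrite -(tot c) // /psum; apply: eq_bigr => i _; rewrite wc.
    move=> T; have := dom c [seq val i | i <- enum T] pc.
    rewrite (map_inj_uniq val_inj) enum_uniq size_map -cardE => /(_ isT).
    rewrite -class_size_sum; last by rewrite (map_inj_uniq val_inj) enum_uniq.
    rewrite big_map big_enum /=; under eq_bigr do rewrite wc.
    by [].
  (* A convex set that contains the weights, hence the Newton polytope, and whose integer points
     satisfy [domi]; nonnegativity lets their coordinates be read as natural numbers. *)
  pose D := [set v : 'rV[R]_k | [/\ \sum_i v 0 i = (psum (nth 0%N la) k)%:R,
     forall T : {set 'I_k}, \sum_(i in T) v 0 i <= (psum (nth 0%N la) #|T|)%:R
     & forall i, 0 <= v 0 i]]%classic.
  have convD : convex_set D.
    move=> x y t t0 t1 [x1 x2 x3] [y1 y2 y3].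
    have t1' : 0 <= 1 - t by rewrite subr_ge0.
    split=> [|T|i].
    + under eq_bigr do rewrite !mxE.
      by rewrite big_split /= -!mulr_sumr x1 y1; ring.
    + under eq_bigr do rewrite !mxE.
      rewrite big_split /= -!mulr_sumr.
      have := ler_wpM2l t0 (x2 T); have := ler_wpM2l t1' (y2 T); lra.
    + by rewrite !mxE addr_ge0 // mulr_ge0.
  have Newton_D : (Newton (chromatic R e k) `<=` D)%classic.
    apply: conv_min => // v /supp_chromatic[a [/weight_domi[a1 a2] ->]].
    split=> [|T|i].
    + by under eq_bigr do rewrite mxE; rewrite -natr_sum a1.
    + by under eq_bigr do rewrite mxE; rewrite -natr_sum ler_nat a2.
    + by rewrite mxE ler0n.
  split.
    apply/seteqP; split=> v.
      move=> sv; split; first exact: subset_conv.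
      by case: sv => m [_ ->] i; rewrite mxE intr_nat.
    move=> [/Newton_D[v1 v2 v3] vint].
    apply/supp_chromatic; exists (fun i => Num.truncn (v 0 i)).
    have vE i : v 0 i = (Num.truncn (v 0 i))%:R.
      by rewrite truncnK // -intrEge0.
    split; last by apply/rowP => i; rewrite mxE.
    apply: domi_weight; split.
      by apply/eqP; rewrite -(eqr_nat R) natr_sum -v1; apply/eqP/eq_bigr.
    by move=> T; rewrite -(ler_nat R) natr_sum -(eq_bigr _ (fun i _ => vE i)).
  apply/seteqP; split; apply: conv_subset => v.
    by move=> /supp_chromatic[a [/weight_domi/domi_conv Ca ->]].
  move=> [s ->]; apply: subset_conv; apply/supp_chromatic.
  exists (fun i => nth 0%N la (s i)); split=> //.
  exact: (is_weight_perm s weight_la).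
(* Now part [k] of [la] is positive. A coloring with [k] colors would give
   [#|V| <= psum (nth 0 la) k], while the parts of [la], which add up to [#|V|], include this
   further one. *)
have supp0 : supp (chromatic R e k) = classical_sets.set0.
  apply/seteqP; split=> // v /supp_chromatic[a [[c pc [ck _]] _]].
  have := dom c (iota 0 k) pc (iota_uniq _ _).
  under eq_bigr do rewrite mem_iota add0n ck.
  rewrite sum1_card size_iota.
  pose K := (maxn k (\max_v c0 v)).+1.
  rewrite -(@psum_class_size V c0 K); last first.
    by move=> v'; rewrite ltnS leq_max leq_bigmax orbT.
  rewrite /psum; under eq_bigr do rewrite wc0.
  rewrite -/(psum (nth 0%N la) K) => leK.
  have kK : (k < K)%N by rewrite ltnS leq_maxl.
  have mono x y : (x <= y -> psum (nth 0%N la) x <= psum (nth 0%N la) y)%N.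
    by move=> /subnKC <-; elim: (y - x)%N => [|n IH]; rewrite ?addn0 // addnS psumS; lia.
  rewrite -/(psum (nth 0%N la) k) in leK.
  by have := mono _ _ kK; rewrite psumS; move: lak leK; lia.
rewrite /SNP /Newton supp0 conv0; split=> //.
by apply/seteqP; split=> v // -[].
Qed.

Local Close Scope ring_scope.

(** * Co-bipartite graphs *)

Lemma size_two_one (n j : nat) : size (two_one n j) = j + (n - j.*2).
Proof. by rewrite size_cat !size_nseq. Qed.

Lemma nth_two_one (n j i : nat) :
  nth 0 (two_one n j) i = if i < j then 2 else if i < j + (n - j.*2) then 1 else 0.
Proof.
rewrite nth_cat size_nseq !nth_nseq; case: ltnP => // ji.
by rewrite ltn_subLR.
Qed.

Lemma psum_two_one (n j t : nat) : j.*2 <= n ->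
  psum (nth 0 (two_one n j)) t = minn (minn t.*2 (t + j)) n.
Proof.
move=> jn; elim: t => [|t IHt]; first by rewrite /psum big_ord0; lia.
by rewrite psumS IHt nth_two_one; case: ifP; [|case: ifP]; lia.
Qed.

Lemma mcoef_neq0 (V : finType) (e : rel V) (la : seq nat) :
  (mcoef e la != 0)%R <-> is_weight e (fun i : 'I_(size la) => nth 0 la i).
Proof.
rewrite /mcoef; split.
  move=> /mcoeff_chromatic_neq0[n|c pc [ck wc]]; first exact: pnatr_eq0.
  by exists c => //; split=> // i; rewrite wc mnmE.
case=> c pc [ck wc]; apply/mcoeff_chromatic_neq0 => [n|]; first exact: pnatr_eq0.
by exists c => //; split=> // i; rewrite wc mnmE.
Qed.

(** Distinct vertices of one color are joined in the complement, so they lie on different sides of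
    its bipartition; this is impossible for three of them. *)
Lemma cobipartite_class_size (V : finType) (e : rel V) (c : V -> nat) (i : nat) :
  cobipartite e -> nat_coloring e c -> class_size c i <= 2.
Proof.
move=> [A bip] pc; rewrite leqNgt; apply/negP.
rewrite /class_size -big_mkcond sum1_card => /card_gt2P[x [y [z]]].
case=> -[/eqP cx /eqP cy /eqP cz] [xy yz zx].
have sep u v : c u = i -> c v = i -> u != v -> (u \in A) != (v \in A).
  move=> cu cv uv; apply: bip; rewrite /complement /= uv /=; apply/negP => /pc.
  by rewrite cu cv.
have := sep x y cx cy xy; have := sep y z cy cz yz; have := sep z x cz cx zx.
by case: (x \in A); case: (y \in A); case: (z \in A).
Qed.

Lemma recolor_vertex (V : finType) (e : rel V) (c : V -> nat) (i j : nat) :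
  irreflexive e -> nat_coloring e c -> class_size c j = 0 -> 0 < class_size c i ->
  exists2 c', nat_coloring e c' &
    forall x, class_size c' x = class_size c x + (x == j) - (x == i).
Proof.
move=> irr pc cj ci.
have nj v : c v <> j.
  move=> cv; move/eqP: cj; rewrite sum_nat_eq0 => /forallP/(_ v).
  by rewrite cv eqxx.
have /existsP[v /eqP cv] : [exists v, c v == i].
  apply: contraLR ci; rewrite negb_exists => /forallP H.
  by rewrite -eqn0Ngt sum_nat_eq0; apply/forallP => v; rewrite (negPf (H v)).
exists (fun w => if w == v then j else c w).
  move=> x y; have [->|xv] := eqVneq x v; have [->|yv] := eqVneq y v.
  - by rewrite irr.
  - by move=> _ /esym /nj.
  - by move=> _ /nj.
  - exact: pc.
move=> x; rewrite /class_size [in LHS](bigD1 v) //= [in RHS](bigD1 v) //= eqxx cv.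
under eq_bigr => w wv do rewrite (negPf wv).
rewrite (eq_sym j) (eq_sym i).
by case: eqP => [->|_]; case: eqP => [E|_]; lia.
Qed.

(** The classes of the colors in [T] are kept, renumbered by their index in [T], and every other
    vertex receives a color of its own. *)
Lemma two_one_weight (V : finType) (e : rel V) (c : V -> nat) (T : seq nat) :
  irreflexive e -> nat_coloring e c -> uniq T -> {in T, forall t, class_size c t = 2} ->
  (size T).*2 <= #|V| /\ (mcoef e (two_one #|V| (size T)) != 0)%R.
Proof.
move=> irr pc uT T2.
have sumT : \sum_v (c v \in T) = (size T).*2.
  rewrite -class_size_sum // big_seq (eq_bigr _ T2) -big_seq.
  by rewrite big_const_seq count_predT iter_addn_0 mul2n.
have TV : (size T).*2 <= #|V|.
  by rewrite -sumT -sum1_card; apply: leq_sum => v _; case: (c v \in T).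
split=> //; apply/mcoef_neq0.
pose s := enum [pred v | c v \notin T].
have sz : size s = #|V| - (size T).*2.
  have := cardC [pred v | c v \in T]; rewrite -cardE -sumT.
  rewrite -[#|[pred v | c v \in T]|]sum1_card big_mkcond /= => <-.
  rewrite (eq_bigr (fun v => (c v \in T) : nat)); last first.
    by move=> v _; rewrite inE; case: (c v \in T).
  by rewrite addKn; apply: eq_card => v; rewrite !inE.
have ms v : (v \in s) = (c v \notin T) by rewrite mem_enum inE.
exists (fun v => if c v \in T then index (c v) T else size T + index v s).
  move=> x y exy; case: ifP => xT; case: ifP => yT.
  - by move=> /(congr1 (nth 0 T)); rewrite !nth_index //; apply: pc.
  - by move=> E; have := xT; rewrite -index_mem E ltnNge leq_addr.
  - by move=> E; have := yT; rewrite -index_mem -E ltnNge leq_addr.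
  - move=> /addnI /(congr1 (nth x s)); rewrite !nth_index ?ms ?xT ?yT // => E.
    by move: exy; rewrite E irr.
split=> [v|[i /=]]; rewrite size_two_one -sz.
  case: ifP => vT; first by rewrite ltn_addr // index_mem.
  by rewrite ltn_add2l index_mem ms vT.
move=> ilt; rewrite nth_two_one -sz ilt; case: ifP => iT.
  rewrite -(T2 (nth 0 T i)) ?mem_nth //; apply: eq_bigr => v _.
  case: ifP => vT; congr nat_of_bool.
    apply/eqP/eqP => [<-|->]; first by rewrite nth_index.
    by rewrite index_uniq.
  by rewrite (_ : (c v == _) = false); [lia|apply/eqP => E; rewrite E mem_nth in vT].
have [v0 _] : exists v, v \in s.
  by case: (s) ilt => [|v l _]; [rewrite /= addn0 iT|exists v; rewrite mem_head].
rewrite /class_size (bigD1 (nth v0 s (i - size T))) //= big1.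
  rewrite -[_ \in T]negbK -ms mem_nth /=; last lia.
  have Ti : size T <= i by rewrite leqNgt iT.
  rewrite index_uniq ?enum_uniq //; last by rewrite ltn_subLR.
  by rewrite (subnKC Ti) eqxx.
move=> v vs; case: ifP => vT.
  apply/eqP; rewrite eqb0; apply/eqP => E.
  by have := vT; rewrite -index_mem E iT.
apply/eqP; rewrite eqb0; apply: contra vs => /eqP <-.
by rewrite addKn nth_index // ms vT.
Qed.

Lemma permutahedral_cobipartite (R : realType) (k : nat) (V : finType) (e : rel V) :
  irreflexive e -> cobipartite e ->
  SNP (chromatic R e k) /\
  Newton (chromatic R e k) = permutahedron R k (lambda_cobip e).
Proof.
move=> irr cobip; rewrite /lambda_cobip; set J := \max_(j < _ | _) _.
have leJ c T : nat_coloring e c -> uniq T -> {in T, forall t, class_size c t = 2} ->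
    size T <= J.
  move=> pc uT T2; have [TV mT] := two_one_weight irr pc uT T2.
  have TV' : size T < (#|V|./2).+1 by rewrite ltnS -(doubleK (size T)) half_leq.
  exact: (leq_bigmax_cond (Ordinal TV')).
have [mJ nJ] : (mcoef e (two_one #|V| J) != 0)%R /\ J.*2 <= #|V|.
  have [|j mj EJ] := @eq_bigmax_cond _ [pred j : 'I_(#|V|./2).+1 |
      (mcoef e (two_one #|V| j) != 0)%R] (fun j => j : nat).
    (* The maximum is attained since [j = 0] is admissible: all vertices may receive different
       colors. *)
    apply/card_gt0P; exists ord0.
    have [|//|//|_] :=
      @two_one_weight V e (fun v => enum_rank v : nat) [::] irr; last exact.
    move=> x y exy /val_inj/enum_rank_inj E; by rewrite E irr in exy.
  have -> : J = j by rewrite -EJ; apply: eq_bigl => l; rewrite inE.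
  split; first exact: mj.
  have := ltn_ord j; rewrite ltnS -[X in _ -> _ <= X]odd_double_half -leq_double => H.
  exact: leq_trans H (leq_addl _ _).
apply: permutahedral_chromatic.
- have /mcoef_neq0[c pc [ck wc]] := mJ; exists c => // i.
  have [isz|isz] := ltnP i (size (two_one #|V| J)); first by rewrite (wc (Ordinal isz)).
  by rewrite nth_default // (proj1 (class_size0 c _) ck).
- move=> c T pc uT; rewrite psum_two_one // !leq_min.
  have le1 : \sum_v (c v \in T) <= #|V|.
    by rewrite -sum1_card; apply: leq_sum => v _; case: (c v \in T).
  (* Each color of [T] counts at most once, plus once more if its class has two vertices; there are
     at most [J] such classes, and at most [size T]. *)
  have le2 : \sum_v (c v \in T) <= size T + size [seq t <- T | class_size c t == 2].
    rewrite -class_size_sum // size_filter -sum1_count -(sum1_size T).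
    rewrite [X in _ <= _ + X]big_mkcond -big_split.
    apply: leq_sum => t _ /=; have := cobipartite_class_size t cobip pc.
    by case: (class_size c t) => [|[|[|]]].
  have := leJ c [seq t <- T | class_size c t == 2] pc (filter_uniq _ uT).
  have := count_size (fun t => class_size c t == 2) T; rewrite -size_filter => sT J'.
  have {}J' : size [seq t <- T | class_size c t == 2] <= J.
    by apply: J' => t; rewrite mem_filter => /andP[/eqP].
  by rewrite le1 andbT -addnn !(leq_trans le2) // leq_add2l.
- move=> c i j pc cij; have := cobipartite_class_size i cobip pc => ci.
  apply: recolor_vertex => //; lia.
Qed.

(** * Indifference graphs *)

(** By pigeonhole, the [size s + 1] candidates cannot all occur in [s], so the search succeeds. *)
Lemma least_unused_notin (s : seq nat) : least_unused s \notin s.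
Proof.
rewrite /least_unused; set p := fun c => c \notin s.
have hp : has p (iota 1 (size s).+1).
  apply/negPn/negP; rewrite -all_predC => /allP H.
  have : (size (iota 1 (size s).+1) <= size s).
    by apply: uniq_leq_size (iota_uniq _ _) _ => x /H /= /negPn.
  by rewrite size_iota ltnn.
have := nth_find 0 hp; rewrite nth_iota ?add1n //.
by rewrite has_find size_iota in hp.
Qed.

Lemma least_unused_min (s : seq nat) (a : nat) :
  0 < a < least_unused s -> a \in s.
Proof.
rewrite /least_unused; set p := fun c => c \notin s => /andP[a0 a1].
have a2 : a.-1 < find p (iota 1 (size s).+1) by lia.
have := find_size p (iota 1 (size s).+1); rewrite size_iota => fs.
have := before_find 0 a2; rewrite nth_iota; last lia.
by rewrite add1n prednK // => /negbFE.
Qed.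

(** Later vertices only append to the list of colors, so the color of [v] can be read off as soon as
    [v] is processed. *)
Definition greedy_color (d : seq step) (v : nat) : nat := nth 0 (greedy d v.+1) v.

Lemma greedyE (d : seq step) (n : nat) : greedy d n = mkseq (greedy_color d) n.
Proof.
have sz m : size (greedy d m) = m by elim: m => //= m IHm; rewrite size_rcons IHm.
apply: (@eq_from_nth _ 0); first by rewrite sz size_mkseq.
move=> i; rewrite sz; elim: n => // n IHn; rewrite ltnS leq_eqVlt => /predU1P[->|i_n].
  by rewrite nth_mkseq.
by rewrite nth_mkseq ?leqW //= nth_rcons sz i_n IHn // nth_mkseq.
Qed.

Lemma greedy_colorE (d : seq step) (v : nat) :
  greedy_color d v =
  least_unused [seq greedy_color d u | u <- iota 0 v & dyck_adj d u v].
Proof.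
rewrite /greedy_color /= nth_rcons greedyE size_mkseq ltnn eqxx.
congr least_unused; apply/eq_in_map => u.
by rewrite mem_filter mem_iota => /andP[_ uv]; rewrite nth_mkseq.
Qed.

Lemma greedy_color_gt0 (d : seq step) (v : nat) : 0 < greedy_color d v.
Proof. by rewrite greedy_colorE. Qed.

(** Positions of East steps increase, and the default position [size d] lies beyond all of them; a
    longer prefix contains at least as many North steps. *)
Lemma hessenberg_mono (d : seq step) (u v : nat) :
  u <= v -> hessenberg d u <= hessenberg d v.
Proof.
move=> uv; rewrite /hessenberg.
have pos : nth (size d) (east_positions d) u <= nth (size d) (east_positions d) v.
  have [vs|vs] := ltnP v (size (east_positions d)).
    apply: (@sorted_leq_nth _ leq leq_trans leqnn (size d)); rewrite ?inE //.
      by apply: sorted_filter; [exact: leq_trans|exact: iota_sorted].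
    exact: leq_ltn_trans vs.
  rewrite [leqRHS]nth_default //.
  have [us|us] := ltnP u (size (east_positions d)); last by rewrite nth_default.
  have := mem_nth (size d) us; rewrite mem_filter mem_iota => /and3P[_ _].
  exact: ltnW.
by rewrite -(cat_take_drop (nth (size d) (east_positions d) u)
  (take (nth (size d) (east_positions d) v) d)) take_takel // count_cat leq_addr.
Qed.

(* [G] is the set of vertices of greedy color at most [m]. A vertex of [W]
   outside [G] is compensated on the clique formed by its left neighbours, which
   contains at least [m] elements of [G] but fewer than [m] other elements of
   [W]. *)
Lemma greedy_max (h : nat -> nat) (m n : nat) (W G : pred nat) :
  (forall u v, u <= v -> h u <= h v) ->
  (forall l v, l <= v -> v < n -> W v -> (forall u, l <= u < v -> v < h u) ->
     \sum_(l <= u < v.+1) W u <= m) ->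
  (forall v, ~~ G v -> m <= \sum_(0 <= u < v | v < h u) G u) ->
  forall t, t <= n -> \sum_(0 <= u < t) W u <= \sum_(0 <= u < t) G u.
Proof.
move=> hmono cliqueW fullG t; have [T] := ubnP t.
elim: T t => // T IHT [|v] tT tn; first by rewrite big_geq.
have IHv := IHT v tT (ltnW tn).
rewrite big_nat_recr //= [leqRHS]big_nat_recr //=.
have [Wv|] := boolP (W v); last by move=> _; apply: leq_add.
have [Gv|nGv] := boolP (G v); first exact: leq_add.
(* [l] is the first left neighbour of [v], or [v] itself if there is none. The induction hypothesis
   is used below [l], the clique bound from [l] to [v]. *)
have [|l /orP lP lmin] := @ex_minnP (fun l => (l == v) || (v < h l)).
  by exists v; rewrite eqxx.
have lv : l <= v by apply: lmin; rewrite eqxx.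
have hl u : l <= u < v -> v < h u.
  case: lP => [/eqP ->|lP /andP[lu _]]; first lia.
  exact: leq_trans lP (hmono _ _ lu).
have Wl := cliqueW l v lv tn Wv hl.
have IHl := IHT l (leq_ltn_trans lv tT) (leq_trans lv (ltnW tn)).
have := fullG v nGv; rewrite (big_cat_nat (leq0n l) lv) /= big_nat_cond big1 ?add0n.
  rewrite big_mkcond /= => Gl.
  have Gl' : m <= \sum_(l <= u < v) G u.
    by apply: leq_trans Gl _; apply: leq_sum => u _; case: ifP.
  rewrite (big_cat_nat (leq0n l) lv) /= [X in _ <= X + _](big_cat_nat (leq0n l) lv) /=.
  rewrite big_nat_recr //= Wv in Wl; lia.
move=> u /andP[/andP[_ ul] vh].
by have := lmin u; rewrite vh orbT; lia.
Qed.

Lemma indifference_coloring (n : nat) (d : seq step) (c : 'I_n -> nat) :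
  (forall x y : 'I_n, x < y < hessenberg d x -> c x <> c y) ->
  nat_coloring (indifference_graph n d) c.
Proof.
by move=> H x y /orP[/H //|/H H' /esym].
Qed.

(** Greedy colors start at 1 and parts are indexed from 0, hence the predecessor; it is injective on
    positive colors. *)
Lemma greedy_coloring (n : nat) (d : seq step) :
  nat_coloring (indifference_graph n d) (fun v => (greedy_color d v).-1).
Proof.
apply: indifference_coloring => x y xy.
have := least_unused_notin [seq greedy_color d u | u <- iota 0 y & dyck_adj d u y].
rewrite -greedy_colorE => /negP H E; apply: H.
apply/mapP; exists (x : nat).
  rewrite mem_filter mem_iota /dyck_adj /= xy /=; lia.
by have := greedy_color_gt0 d x; have := greedy_color_gt0 d y; lia.
Qed.

Lemma greedy_class_size (n : nat) (d : seq step) (i : nat) :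
  class_size (fun v : 'I_n => (greedy_color d v).-1) i = nth 0 (lambda_gr n d) i.
Proof.
rewrite /lambda_gr /weight; set M := (\max_(_ <- _) _)%N.
have -> : class_size (fun v : 'I_n => (greedy_color d v).-1) i =
    count_mem i.+1 (greedy d n).
  rewrite greedyE /mkseq count_map -sum1_count big_mkcond /=.
  rewrite -[X in iota 0 X]subn0 -/(index_iota 0 n) big_mkord; apply: eq_bigr => v _.
  by case: (greedy_color d v) (greedy_color_gt0 d v) => //= a _; rewrite eqSS; case: eqP.
have [iM|iM] := ltnP i M.
  by rewrite (nth_map 0) ?size_iota // nth_iota // add1n.
rewrite nth_default ?size_map ?size_iota //.
apply/eqP; rewrite -leqn0 leqNgt -has_count has_pred1; apply/negP => iG.
by have := leq_bigmax_seq (P := xpredT) (F := id) _ iG isT; rewrite -/M; lia.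
Qed.

(** In [greedy_max], [W] is the set of vertices colored from [T] and [G] that of vertices of greedy
    color at most [size T]. On a clique [c] is injective, so [W] has at most [size T] vertices
    there; a vertex outside [G] has left neighbours of every greedy color from 1 to [size T]. *)
Lemma greedy_dominates (n : nat) (d : seq step) (c : 'I_n -> nat) (T : seq nat) :
  nat_coloring (indifference_graph n d) c -> uniq T ->
  \sum_v (c v \in T) <= psum (nth 0 (lambda_gr n d)) (size T).
Proof.
move=> pc uT.
pose W v := if insub v is Some x then c x \in T else false.
pose G v := greedy_color d v <= size T.
have WE (v : 'I_n) : W v = (c v \in T) by rewrite /W valK.
have -> : psum (nth 0 (lambda_gr n d)) (size T) = \sum_(0 <= v < n) G v.
  transitivity (\sum_(i < size T) class_size (fun v : 'I_n => (greedy_color d v).-1) i).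
    by apply: eq_bigr => i _; rewrite greedy_class_size.
  rewrite -(big_mkord predT (class_size (fun v : 'I_n => (greedy_color d v).-1))).
  rewrite class_size_sum ?iota_uniq // big_mkord; apply: eq_bigr => v _.
  rewrite mem_iota subn0 /G; have := greedy_color_gt0 d v; lia.
have -> : \sum_v (c v \in T) = \sum_(0 <= v < n) W v.
  by rewrite big_mkord; apply: eq_bigr => v _; rewrite WE.
apply: (@greedy_max (hessenberg d) (size T) n) => //.
- exact: hessenberg_mono.
- move=> l v lv vn Wv clq.
  pose Q := [seq x : 'I_n <- enum 'I_n | (l <= x <= v) && (c x \in T)].
  have -> : \sum_(l <= u < v.+1) W u = size [seq c x | x <- Q].
    rewrite size_map size_filter -sum1_count big_enum_cond /= [RHS]big_mkcond /=.
    rewrite (big_nat_widenl _ 0) // (big_nat_widen _ _ n) // big_mkord.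
    rewrite [LHS]big_mkcond /=; apply: eq_bigr => x _.
    by rewrite WE ltnS; case: (c x \in T); case: (l <= x); case: (x <= v).
  apply: uniq_leq_size => [|_ /mapP[x + ->]]; last first.
    by rewrite mem_filter => /andP[/andP[_ ->]].
  rewrite map_inj_in_uniq; first by rewrite filter_uniq // enum_uniq.
  move=> x y; rewrite !mem_filter.
  move=> /andP[/andP[/andP[lx xv] _] _] /andP[/andP[/andP[ly yv] _] _] E.
  have adj (x' y' : 'I_n) : l <= x' -> y' <= v -> x' < y' -> c x' <> c y'.
    move=> lx' yv' xy; apply: pc; rewrite /indifference_graph /dyck_adj /= xy /=.
    by have := clq x'; lia.
  apply: val_inj => /=; case: (ltngtP x y) => // xy; first by case: (adj x y).
  by case: (adj y x).
- move=> v; rewrite /G -ltnNge => Gv.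
  have sub : {subset iota 1 (size T) <= [seq greedy_color d u |
      u <- [seq u <- iota 0 v | dyck_adj d u v & greedy_color d u <= size T]]}.
    move=> a; rewrite mem_iota => aT.
    have := @least_unused_min [seq greedy_color d u | u <- iota 0 v & dyck_adj d u v] a.
    rewrite -greedy_colorE => /(_ _)/mapP[|u]; first lia.
    rewrite mem_filter => /andP[adj ui] Ea; apply/mapP; exists u => //.
    by rewrite mem_filter adj -Ea ui; lia.
  have := uniq_leq_size (iota_uniq _ _) sub.
  rewrite size_iota size_map size_filter -sum1_count => /leq_trans; apply.
  rewrite big_mkcond [leqRHS]big_mkcond /= /index_iota subn0 big_seq [leqRHS]big_seq.
  apply: leq_sum => u; rewrite mem_iota /dyck_adj /= => uv.
  case: (greedy_color d u <= size T); rewrite ?andbF ?andbT //.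
  case: ifP => //; case: ifP => //; lia.
Qed.

(* Scanning the vertices from left to right, let [u] be the vertex at which
   color [i] first leads color [j] by two, and [s < u] the previous vertex
   colored [i] or [j]; it is also colored [i]. No edge between these two colors
   crosses from below [u] to [u] or above, since it would make [s] and [u]
   adjacent, so the two colors can be exchanged below [u]. *)
Lemma indifference_move (n : nat) (d : seq step) (c : 'I_n -> nat) (i j : nat) :
  nat_coloring (indifference_graph n d) c -> class_size c j + 2 <= class_size c i ->
  exists2 c', nat_coloring (indifference_graph n d) c' &
    forall x, class_size c' x = class_size c x + (x == j) - (x == i).
Proof.
move=> pc cij.
pose A l t := \sum_(v < n) ((v < t) && (c v == l) : nat).
have A0 l : A l 0 = 0 by apply: big1.
have An l : A l n = class_size c l by apply: eq_bigr => v _; rewrite ltn_ord.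
have AS l (v : 'I_n) : A l v.+1 = A l v + (c v == l).
  rewrite /A [LHS](bigD1 v) //= [in RHS](bigD1 v) //= ltnSn ltnn add0n addnC.
  congr (_ + _); apply: eq_bigr => w wv; congr (nat_of_bool (_ && _)).
  by rewrite ltnS leq_eqVlt; case: eqP => // /val_inj E; rewrite E eqxx in wv.
have ij : i <> j by move=> E; move: cij; rewrite E; lia.
have [|[|u] /andP[tn tP] tmin] := @ex_minnP (fun t => (t <= n) && (A j t + 2 <= A i t)).
- by exists n; rewrite leqnn !An.
- by rewrite !A0 in tP.
have uP t : t <= u -> A i t < A j t + 2.
  by move=> tu; rewrite ltnNge; apply/negP => tP'; have := tmin t; rewrite tP'; lia.
have := uP u (leqnn u) => Au.
(* [s] is the last prefix length up to [u] at which [i] does not lead; afterwards the lead is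
   exactly one. Hence vertex [s] has color [i], and neither color occurs strictly between [s] and
   [u]. *)
have [||s /andP[su sP] smax] := @ex_maxnP (fun s => (s <= u) && (A i s <= A j s)) u.
- by exists 0; rewrite !A0.
- by move=> s /andP[].
have step (v : nat) (vn : v < n) : A i v.+1 = A i v + (c (Ordinal vn) == i) /\
    A j v.+1 = A j v + (c (Ordinal vn) == j).
  by split; apply: (AS _ (Ordinal vn)).
have [] := step u tn; set cu := c _ => iu ju.
have cui : cu = i by apply/eqP; move: tP iu ju; case: (cu == i) => //; lia.
have cuj : (cu == j) = false by apply/eqP; rewrite cui.
have su' : s < u.
  rewrite ltn_neqAle su andbT; apply/eqP => E; move: sP; rewrite E; lia.
have mid t : s < t -> t <= u -> A i t = A j t + 1.
  move=> st tu; have := uP t tu; have := smax t; rewrite tu /=; lia.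
have sn : s < n by lia.
have [] := step s sn; set cs := c _ => is_ js.
have csi : cs = i.
  have := mid s.+1 (ltnSn s) su'; apply: contraPeq => csi.
  by rewrite is_ js (negPf csi); lia.
have gap (v : 'I_n) : v < u -> (c v == i) || (c v == j) -> v <= s.
  move=> vu cv; rewrite leqNgt; apply/negP => sv.
  have := mid v sv (ltnW vu); have := mid v.+1 (ltnW sv) vu; rewrite !AS.
  by case/orP: cv => /eqP ->; rewrite eqxx; [rewrite (introF eqP ij)|
    rewrite (introF eqP (nesym ij))]; lia.
pose sw a := if a == i then j else if a == j then i else a.
have sw_inj : injective sw.
  by move=> a b; rewrite /sw; do !case: eqP => //; lia.
pose c' (v : 'I_n) := if v < u then sw (c v) else c v.
have clean (x y : 'I_n) : x < u -> u <= y -> y < hessenberg d x ->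
    (c x == i) || (c x == j) -> False.
  move=> xu uy yh /(gap x xu) xs.
  have := pc (Ordinal sn) (Ordinal tn); rewrite -/cs -/cu csi cui; apply => //.
  apply/orP; left; rewrite /= su' /=.
  have := hessenberg_mono d xs; lia.
exists c'.
  apply: indifference_coloring => x y /andP[xy yh].
  have cxy : c x <> c y by apply: pc; rewrite /indifference_graph /dyck_adj /= xy yh.
  rewrite /c'; have [xu|ux] := ltnP x u; have [yu|uy] := ltnP y u => //.
  - by move/sw_inj.
  - rewrite /sw; case: eqP => [cxi _|_].
      by apply: (clean x y) => //; rewrite cxi eqxx.
    by case: eqP => // cxj _; apply: (clean x y) => //; rewrite cxj eqxx orbT.
  - by lia.
(* The exchange swaps the counts of [i] and [j] below [u], which differ by one, so a single unit
   moves. *)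
have sizes l : class_size c' l + A l u = class_size c l + A (sw l) u.
  rewrite /class_size /A -!big_split; apply: eq_bigr => v _ /=.
  rewrite /c'; case: ltnP => _ //=.
  have -> : (sw (c v) == l) = (c v == sw l).
    by rewrite -(inj_eq sw_inj) /sw; congr (_ == _); do !case: eqP => //; lia.
  by rewrite addnC.
move=> l; have := sizes l; have := mid u su' (leqnn u); rewrite /sw.
have [->|li] := eqVneq l i; first by rewrite (introF eqP ij); lia.
have [->|lj] := eqVneq l j; lia.
Qed.

Lemma permutahedral_indifference (R : realType) (k n : nat) (d : seq step) :
  SNP (chromatic R (indifference_graph n d) k) /\
  Newton (chromatic R (indifference_graph n d) k) = permutahedron R k (lambda_gr n d).
Proof.
apply: permutahedral_chromatic.
- exists (fun v : 'I_n => (greedy_color d v).-1); first exact: greedy_coloring.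
  exact: greedy_class_size.
- exact: greedy_dominates.
- exact: indifference_move.
Qed.

(** * Part listings *)

Definition part_lt (p : part) : rel (part_vertex p) :=
  [rel x y | (part_level y == (part_level x).+1) && part_edge x y].
Arguments part_lt : clear implicits.

Definition part_incomparability (p : part) : rel (part_vertex p) :=
  [rel x y | [&& x != y, ~~ part_lt p x y & ~~ part_lt p y x]].
Arguments part_incomparability : clear implicits.

(* A profile records the pairs (level, color) of the vertices, with
   multiplicity; [compat w1 w2] says that two words of parts with these profiles
   can be concatenated without creating a monochromatic incomparable pair. *)
Definition part_profile (p : part) (w : seq (nat * nat)) : Prop :=
  exists2 c, nat_coloring (part_incomparability p) c
    & perm_eq w [seq (part_level v, c v) | v <- enum (part_vertex p)].

Definition listing_profile (L : listing) (w : seq (nat * nat)) : Prop :=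
  exists2 c, nat_coloring (listing_incomparability L) c
    & perm_eq w [seq (level v, c v) | v <- enum (listing_vertex L)].

Definition compat (w1 w2 : seq (nat * nat)) : Prop :=
  {in w1 & w2, forall x y, x.2 = y.2 -> ~~ (y.1 <= x.1 <= y.1.+1)}.

Lemma eq_map_perm (T : Type) (T' : eqType) (f g : T -> T') (s : seq T) :
  f =1 g -> perm_eq (map f s) (map g s).
Proof. by move=> /eq_map ->. Qed.

Lemma part_level_lt (p : part) (x y : part_vertex p) :
  part_level y < part_level x + 2.
Proof. by case: p x y => [i|i r s H] /= x y; [|case: x; case: y]; lia. Qed.

Lemma part_incomparabilityE (p : part) (x y : part_vertex p) :
  part_incomparability p x y = [&& x != y, ~~ part_lt p x y & ~~ part_lt p y x].
Proof. by []. Qed.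

Lemma listing_incomparabilityE (L : listing) (x y : listing_vertex L) :
  listing_incomparability L x y =
  [&& x != y, ~~ listing_lt x y & ~~ listing_lt y x].
Proof. by []. Qed.

(** * Profiles of words: adding one part, concatenation *)

Section Cons.

Context (p : part) (L : listing).

(** The part at a position of [L] and the part at the shifted position of [p :: L] are only provably
    equal, so vertices must be transported. *)
Definition cast_vertex (q r : part) (E : q = r) (v : part_vertex q) :
  part_vertex r := eq_rect q (fun r => part_vertex r : Type) v r E.

Lemma cast_vertexK (q r : part) (E : q = r) :
  cancel (cast_vertex E) (cast_vertex (esym E)).
Proof. by case: r / E. Qed.

Lemma cast_vertexKV (q r : part) (E : q = r) :
  cancel (cast_vertex (esym E)) (cast_vertex E).
Proof. by case: r / E. Qed.

Lemma part_level_cast (q r : part) (E : q = r) (v : part_vertex q) :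
  part_level (cast_vertex E v) = part_level v.
Proof. by case: r / E. Qed.

Lemma part_edge_cast (q r : part) (E : q = r) (v w : part_vertex q) :
  part_edge (cast_vertex E v) (cast_vertex E w) = part_edge v w.
Proof. by case: r / E. Qed.

Lemma part_at_lift (q : 'I_(size L)) :
  part_at q = part_at (lift ord0 q : 'I_(size (p :: L))).
Proof. by rewrite /part_at !(tnth_nth (Single 0)) /=. Qed.

Definition head_vertex (v : part_vertex p) : listing_vertex (p :: L) :=
  Tagged (fun q : 'I_(size (p :: L)) => part_vertex (part_at q))
    (i := ord0) v.

Definition tail_vertex (y : listing_vertex L) : listing_vertex (p :: L) :=
  Tagged (fun q : 'I_(size (p :: L)) => part_vertex (part_at q))
    (cast_vertex (part_at_lift (tag y)) (tagged y)).

Lemma head_vertex_inj : injective head_vertex.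
Proof. by move=> v w /eqP; rewrite eq_Tagged => /eqP. Qed.

Lemma tail_vertex_inj : injective tail_vertex.
Proof.
move=> [q v] [q' v'] E; have /= /lift_inj Eq := congr1 (@tag _ _) E.
move: v' E; rewrite -Eq => v' /eqP; rewrite eq_Tagged /= => /eqP E.
by rewrite -(cast_vertexK (part_at_lift q) v) E cast_vertexK.
Qed.

Lemma head_tail_vertex (v : part_vertex p) (y : listing_vertex L) :
  head_vertex v <> tail_vertex y.
Proof. by move=> /(congr1 (@tag _ _)). Qed.

Lemma cons_vertexP (z : listing_vertex (p :: L)) :
  (exists v, z = head_vertex v) \/ (exists y, z = tail_vertex y).
Proof.
case: z => q v; case: (unliftP ord0 q) v => [q' ->|->] v; last by left; exists v.
right; exists (Tagged (fun q => part_vertex (part_at q))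
  (cast_vertex (esym (part_at_lift q')) v)).
by rewrite /tail_vertex /= cast_vertexKV.
Qed.

Lemma level_head (v : part_vertex p) : level (head_vertex v) = part_level v.
Proof. by []. Qed.

Lemma level_tail (y : listing_vertex L) : level (tail_vertex y) = level y.
Proof. exact: part_level_cast. Qed.

Lemma listing_lt_head (v w : part_vertex p) :
  listing_lt (head_vertex v) (head_vertex w) = part_lt p v w.
Proof.
rewrite /listing_lt /= ltnn andbF /= ?eqxx /= !level_head tagged_asE /=.
by have := part_level_lt v w; rewrite ltnNge => /negPf ->.
Qed.

Lemma listing_lt_tail (y z : listing_vertex L) :
  listing_lt (tail_vertex y) (tail_vertex z) = listing_lt y z.
Proof.
rewrite /listing_lt /= !level_tail /bump /= !add1n ltnS (inj_eq (@lift_inj _ ord0)).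
case: y z => [q v] [q' v'] /=; case: (eqVneq q q') v' => [<-|_] v'; last by [].
by rewrite /tail_vertex /= !tagged_asE part_edge_cast.
Qed.

Lemma listing_lt_head_tail (v : part_vertex p) (y : listing_vertex L) :
  listing_lt (head_vertex v) (tail_vertex y) = (part_level v < level y).
Proof.
rewrite /listing_lt /= level_head level_tail andbF orbF andbT.
by rewrite addn2 [RHS]leq_eqVlt eq_sym orbC.
Qed.

Lemma listing_lt_tail_head (v : part_vertex p) (y : listing_vertex L) :
  listing_lt (tail_vertex y) (head_vertex v) = (level y + 2 <= part_level v).
Proof. by rewrite /listing_lt /= level_head level_tail !andbF !orbF. Qed.

Lemma incomparability_head (v w : part_vertex p) :
  listing_incomparability (p :: L) (head_vertex v) (head_vertex w) =
  part_incomparability p v w.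
Proof.
by rewrite listing_incomparabilityE !listing_lt_head (inj_eq head_vertex_inj).
Qed.

Lemma incomparability_tail (y z : listing_vertex L) :
  listing_incomparability (p :: L) (tail_vertex y) (tail_vertex z) =
  listing_incomparability L y z.
Proof.
by rewrite !listing_incomparabilityE !listing_lt_tail (inj_eq tail_vertex_inj).
Qed.

(** The head part comes first, so [v] is below all tail vertices of higher level, but above only
    those at least two levels lower. The remaining range is the one in [compat]. *)
Lemma incomparability_head_tail (v : part_vertex p) (y : listing_vertex L) :
  listing_incomparability (p :: L) (head_vertex v) (tail_vertex y) =
  (level y <= part_level v <= (level y).+1).
Proof.
rewrite listing_incomparabilityE listing_lt_head_tail listing_lt_tail_head.
by rewrite (introN eqP (@head_tail_vertex v y)); lia.
Qed.

Lemma enum_cons_listing :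
  perm_eq (enum (listing_vertex (p :: L)))
    ([seq head_vertex v | v <- enum (part_vertex p)] ++
     [seq tail_vertex y | y <- enum (listing_vertex L)]).
Proof.
apply: uniq_perm; first exact: enum_uniq.
  rewrite cat_uniq (map_inj_uniq head_vertex_inj) (map_inj_uniq tail_vertex_inj).
  rewrite !enum_uniq /= andbT; apply/hasPn => _ /mapP[y _ ->].
  by apply/mapP => -[v _] /esym/head_tail_vertex.
move=> z; rewrite mem_enum mem_cat; apply/esym/orP.
by case: (cons_vertexP z) => -[v ->]; [left|right]; rewrite map_f // mem_enum.
Qed.

Lemma map_enum_cons_listing (T : eqType) (f : listing_vertex (p :: L) -> T) :
  perm_eq [seq f z | z <- enum (listing_vertex (p :: L))]
    ([seq f (head_vertex v) | v <- enum (part_vertex p)] ++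
     [seq f (tail_vertex y) | y <- enum (listing_vertex L)]).
Proof.
have comp (A : Type) (g : A -> listing_vertex (p :: L)) s :
  [seq f (g x) | x <- s] = map f (map g s) by rewrite -map_comp.
rewrite (comp _ head_vertex) (comp _ tail_vertex) -map_cat.
exact/perm_map/enum_cons_listing.
Qed.

(** Colorings restrict to head and tail. They glue back because a conflict between the two depends
    only on levels and colors, hence only on the profiles. *)
Lemma listing_profile_cons (w : seq (nat * nat)) :
  listing_profile (p :: L) w <->
  exists w1 w2, [/\ perm_eq w (w1 ++ w2), part_profile p w1, listing_profile L w2
    & compat w1 w2].
Proof.
split=> [[c pc wc]|[w1 [w2 [ww [c1 pc1 wc1] [c2 pc2 wc2] cpt]]]].
  exists [seq (part_level v, c (head_vertex v)) | v <- enum (part_vertex p)].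
  exists [seq (level v, c (tail_vertex v)) | v <- enum (listing_vertex L)].
  split.
  - apply: perm_trans wc _; apply: perm_trans (map_enum_cons_listing _) _.
    apply: perm_cat => //; apply: eq_map_perm => y.
    by rewrite /= level_tail.
  - exists (fun v => c (head_vertex v)) => // v v' vv'; apply: pc.
    by rewrite incomparability_head.
  - exists (fun v => c (tail_vertex v)) => // v v' vv'; apply: pc.
    by rewrite incomparability_tail.
  - move=> _ _ /mapP[v _ ->] /mapP[y _ ->] /= E; apply/negP.
    by rewrite -incomparability_head_tail => /pc.
(* Every vertex comes from the head or the tail, so the default 0 is never reached. *)
pose c z := if [pick v | head_vertex v == z] is Some v then c1 v
            else if [pick y | tail_vertex y == z] is Some y then c2 y else 0.
have ch v : c (head_vertex v) = c1 v.
  rewrite /c; case: pickP => [v' /eqP /head_vertex_inj -> //|/(_ v)].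
  by rewrite eqxx.
have ct y : c (tail_vertex y) = c2 y.
  rewrite /c; case: pickP => [v' /eqP /head_tail_vertex //|_].
  by case: pickP => [y' /eqP /tail_vertex_inj -> //|/(_ y)]; rewrite eqxx.
have cross v y : listing_incomparability (p :: L) (head_vertex v) (tail_vertex y) ->
    c (head_vertex v) <> c (tail_vertex y).
  rewrite incomparability_head_tail ch ct => vy E.
  apply/negP: vy; apply: (cpt (part_level v, c1 v) (level y, c2 y)) => //.
    by rewrite (perm_mem wc1) (map_f (fun v => (part_level v, c1 v))) // mem_enum.
  by rewrite (perm_mem wc2) (map_f (fun y => (level y, c2 y))) // mem_enum.
exists c.
  move=> z z'; case: (cons_vertexP z) => -[x ->]; case: (cons_vertexP z') => -[x' ->].
  - by rewrite incomparability_head !ch; apply: pc1.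
  - exact: cross.
  - move=> xx' /esym; apply: cross.
    by move: xx'; rewrite !listing_incomparabilityE eq_sym => /and3P[-> -> ->].
  - by rewrite incomparability_tail !ct; apply: pc2.
apply: perm_trans ww _; rewrite perm_sym.
apply: perm_trans (map_enum_cons_listing _) _; rewrite perm_sym.
apply: perm_cat.
  by apply: perm_trans wc1 _; apply: eq_map_perm => v; rewrite /= ch.
by apply: perm_trans wc2 _; apply: eq_map_perm => v; rewrite /= ct level_tail.
Qed.

End Cons.

Lemma listing_profile_nil (w : seq (nat * nat)) :
  listing_profile [::] w <-> w = [::].
Proof.
have E : enum (listing_vertex [::]) = [::].
  by case: (enum _) => // -[[]].
split=> [[c _]|->]; first by rewrite E => /perm_nilP.
by exists (fun=> 0); [case=> -[]|rewrite E].
Qed.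

Lemma part_profile_perm (p : part) (w w' : seq (nat * nat)) :
  perm_eq w w' -> part_profile p w -> part_profile p w'.
Proof.
by move=> ww' [c pc wc]; exists c => //; rewrite -(permPl ww').
Qed.

Lemma listing_profile_perm (L : listing) (w w' : seq (nat * nat)) :
  perm_eq w w' -> listing_profile L w -> listing_profile L w'.
Proof.
by move=> ww' [c pc wc]; exists c => //; rewrite -(permPl ww').
Qed.

Lemma listing_profile1 (p : part) (w : seq (nat * nat)) :
  listing_profile [:: p] w <-> part_profile p w.
Proof.
rewrite listing_profile_cons; split=> [[w1 [w2 [ww pw /listing_profile_nil E _]]]|pw].
  by apply: part_profile_perm pw; rewrite perm_sym -[w1]cats0 -E.
exists w, [::]; split=> //; first by rewrite cats0.
exact/listing_profile_nil.
Qed.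

Lemma compat_perm (w1 w1' w2 w2' : seq (nat * nat)) :
  perm_eq w1 w1' -> perm_eq w2 w2' -> compat w1 w2 -> compat w1' w2'.
Proof.
move=> p1 p2 cpt x y; rewrite -(perm_mem p1) -(perm_mem p2); exact: cpt.
Qed.

Lemma compat_catr (w1 w2 w3 : seq (nat * nat)) :
  compat w1 (w2 ++ w3) <-> compat w1 w2 /\ compat w1 w3.
Proof.
split=> [cpt|[c2 c3] x y xw].
  by split=> x y xw yw; apply: cpt; rewrite ?mem_cat ?yw ?orbT.
by rewrite mem_cat => /orP[]; [apply: c2|apply: c3].
Qed.

Lemma compat_catl (w1 w2 w3 : seq (nat * nat)) :
  compat (w1 ++ w2) w3 <-> compat w1 w3 /\ compat w2 w3.
Proof.
split=> [cpt|[c1 c2] x y].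
  by split=> x y xw yw; apply: cpt; rewrite ?mem_cat ?xw ?orbT.
by rewrite mem_cat => /orP[]; [apply: c1|apply: c2].
Qed.

Lemma listing_profile_cat (L1 L2 : listing) (w : seq (nat * nat)) :
  listing_profile (L1 ++ L2) w <->
  exists w1 w2, [/\ perm_eq w (w1 ++ w2), listing_profile L1 w1,
    listing_profile L2 w2 & compat w1 w2].
Proof.
elim: L1 w => [|p L1 IHL] w /=.
  split=> [Lw|[w1 [w2 [ww /listing_profile_nil w10 Lw2 _]]]].
    by exists [::], w; split=> //; apply/listing_profile_nil.
  by apply: listing_profile_perm Lw2; rewrite perm_sym (permPl ww) w10.
rewrite listing_profile_cons; split.
  move=> [w1 [w2 [ww pw1 /IHL[w3 [w4 [ww2 Lw3 Lw4 c34]]] c12]]].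
  have /compat_catr[c13 c14] := compat_perm (perm_refl _) ww2 c12.
  exists (w1 ++ w3), w4; split=> //.
  - by rewrite -catA; apply: perm_trans ww _; rewrite perm_cat2l.
  - by apply/listing_profile_cons; exists w1, w3; split.
  - exact/compat_catl.
move=> [w1 [w2 [ww /listing_profile_cons[w3 [w4 [ww1 pw3 Lw4 c34]]] Lw2 c12]]].
have /compat_catl[c32 c42] := compat_perm ww1 (perm_refl _) c12.
exists w3, (w4 ++ w2); split=> //.
- by rewrite catA; apply: perm_trans ww _; rewrite perm_cat2r.
- by apply/IHL; exists w4, w2; split.
- exact/compat_catr.
Qed.

(** * Maximum matchings of bicolored graphs *)

Lemma matching_extend (r s : nat) (M : {set 'I_r * 'I_s}) :
  matching M -> exists2 M', M' \in max_matchings r s & M \subset M'.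
Proof.
have fst_inj (N : {set 'I_r * 'I_s}) : matching N -> {in N &, injective fst}.
  move=> /forall_inP mN u v uN vN E; apply/eqP; apply: contraT => uv.
  by have /forall_inP/(_ v vN) := mN u uN; rewrite uv E eqxx.
have snd_inj (N : {set 'I_r * 'I_s}) : matching N -> {in N &, injective snd}.
  move=> /forall_inP mN u v uN vN E; apply/eqP; apply: contraT => uv.
  by have /forall_inP/(_ v vN) := mN u uN; rewrite uv E eqxx andbF.
have bound (N : {set 'I_r * 'I_s}) : matching N -> #|N| <= minn r s.
  move=> mN; rewrite leq_min; apply/andP; split.
    by rewrite -(card_in_imset (fst_inj N mN)) -[leqRHS]card_ord max_card.
  by rewrite -(card_in_imset (snd_inj N mN)) -[leqRHS]card_ord max_card.
have [m] := ubnP (minn r s - #|M|); elim: m M => // m IHm M ltm mM.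
have [E|] := eqVneq #|M| (minn r s).
  by exists M; rewrite // inE mM E eqxx.
rewrite eqn_leq bound //= -ltnNge leq_min => /andP[Mr Ms].
(* A matching with fewer than [minn r s] edges leaves a vertex free in each class, and any such pair
   may be added, since all pairs are allowed as edges. *)
have free n (A : {set 'I_n}) : #|A| < n -> exists a, a \notin A.
  move=> An; have /set0Pn[a] : ~: A != set0.
    by rewrite -card_gt0 cardsCs setCK card_ord subn_gt0.
  by rewrite inE => aA; exists a.
have [|a aM] := @free r (fst @: M); first by rewrite (card_in_imset (fst_inj M mM)).
have [|b bM] := @free s (snd @: M); first by rewrite (card_in_imset (snd_inj M mM)).
have abM : (a, b) \notin M by apply: contra aM => abM; apply/imsetP; exists (a, b).
have mM' : matching ((a, b) |: M).
  have ne u : u \in M -> (a != u.1) && (b != u.2).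
    move=> uM; apply/andP; split.
      by apply: contra aM => /eqP ->; apply: imset_f.
    by apply: contra bM => /eqP ->; apply: imset_f.
  apply/forall_inP => u uM; apply/forall_inP => v vM; apply/implyP => uv.
  move: uM vM uv; rewrite !in_setU1 => /predU1P[->|uM] /predU1P[->|vM].
  - by rewrite eqxx.
  - by rewrite /= ne.
  - by move=> _; rewrite /= eq_sym (eq_sym u.2) ne.
  - by move=> uv; have /forall_inP/(_ v vM)/implyP := forall_inP mM u uM; apply.
have [|M' M'max sM'] := IHm _ _ mM'.
  by rewrite cardsU1 abM; have := bound _ mM'; rewrite cardsU1 abM; lia.
by exists M' => //; apply: subset_trans sM'; apply: subsetUr.
Qed.

Lemma matching_sub (r s : nat) (M N : {set 'I_r * 'I_s}) :
  matching M -> N \subset M -> matching N.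
Proof.
move=> mM /subsetP NM; apply/forall_inP => u /NM uM; apply/forall_inP => v /NM vM.
exact: (forall_inP (forall_inP mM u uM)).
Qed.

Lemma matching_prob_neq0 (r s : nat) (H : 'I_r -> 'I_s -> bool) (j : nat) :
  (matching_prob H j != 0)%R =
  [exists M in max_matchings r s, #|[set u in M | H u.1 u.2]| == j].
Proof.
rewrite /matching_prob mulf_eq0 invr_eq0 !pnatr_eq0 negb_or !cards_eq0.
apply/andP/exists_inP => [[/set0Pn[M]]|[M Mm Mj]].
  by rewrite inE => /andP[Mm Mj] _; exists M.
split; apply/set0Pn; exists M => //.
by rewrite inE Mm.
Qed.

(** Extending [M] to [minn r s] edges keeps its edges in common with [H]. With
    [max_common_attained], this identifies [max_common H] as the size of a maximum matching of
    [H]. *)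
Lemma max_common_ge (r s : nat) (H : 'I_r -> 'I_s -> bool) (M : {set 'I_r * 'I_s}) :
  matching M -> {in M, forall u, H u.1 u.2} -> #|M| <= max_common H.
Proof.
move=> mM HM; have [M' M'm sM] := matching_extend mM.
pose N := [set u in M' | H u.1 u.2].
have MN : M \subset N by apply/subsetP => u uM; rewrite inE (subsetP sM) ?HM.
have Nlt : #|N| < (minn r s).+1.
  move: (M'm); rewrite inE => /andP[_ /eqP <-]; rewrite ltnS subset_leq_card //.
  by apply/subsetP => u; rewrite inE => /andP[].
apply: leq_trans (subset_leq_card MN) _.
rewrite /max_common (leq_bigmax_cond (Ordinal Nlt)) //= matching_prob_neq0.
by apply/exists_inP; exists M'.
Qed.

Lemma max_common_attained (r s : nat) (H : 'I_r -> 'I_s -> bool) :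
  exists M : {set 'I_r * 'I_s},
    [/\ matching M, {in M, forall u, H u.1 u.2} & #|M| = max_common H].
Proof.
have m0 : matching (set0 : {set 'I_r * 'I_s}) by apply/forall_inP => u; rewrite inE.
have [M0 M0m _] := matching_extend m0.
pose N0 := [set u in M0 | H u.1 u.2].
have Nlt : #|N0| < (minn r s).+1.
  move: (M0m); rewrite inE => /andP[_ /eqP <-]; rewrite ltnS subset_leq_card //.
  by apply/subsetP => u; rewrite inE => /andP[].
have [|j mj EJ] := @eq_bigmax_cond _ [pred j : 'I_(minn r s).+1 |
    (matching_prob H j != 0)%R] (fun j => j : nat).
  apply/card_gt0P; exists (Ordinal Nlt); rewrite inE /= matching_prob_neq0.
  by apply/exists_inP; exists M0.
move: mj; rewrite inE /= matching_prob_neq0 => /exists_inP[M Mm /eqP Mj].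
exists [set u in M | H u.1 u.2]; split.
- move: Mm; rewrite inE => /andP[mM _]; apply: matching_sub mM _.
  by apply/subsetP => u; rewrite inE => /andP[].
- by move=> u; rewrite inE => /andP[].
- by rewrite Mj -EJ; apply: eq_bigl => l; rewrite inE.
Qed.

Lemma max_common_le (r s : nat) (H : 'I_r -> 'I_s -> bool) : max_common H <= minn r s.
Proof. by apply/bigmax_leqP => j _; rewrite -ltnS. Qed.

(** * Profiles of bicolored parts and of the words that replace them *)

Definition at_level (l : nat) (A : seq nat) : seq (nat * nat) := [seq (l, a) | a <- A].

Lemma at_level_cat (l : nat) (A B : seq nat) :
  at_level l (A ++ B) = at_level l A ++ at_level l B.
Proof. exact: map_cat. Qed.

Lemma compat_at_level (l l' : nat) (A B : seq nat) :
  compat (at_level l A) (at_level l' B) <->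
  (l' <= l <= l'.+1 -> ~~ has (mem A) B).
Proof.
split=> [cpt ll'|H _ _ /mapP[a aA ->] /mapP[b bB ->] /= ab].
  apply/hasPn => b bB; apply/negP => bA.
  by have := cpt (l, b) (l', b) (map_f _ bA) (map_f _ bB) erefl; rewrite ll'.
by apply/negP => /H /hasPn/(_ b bB); rewrite /= -ab aA.
Qed.

Lemma listing_profile_single (m l : nat) (w : seq (nat * nat)) :
  listing_profile (nseq m (Single l)) w <->
  exists A, [/\ uniq A, size A = m & perm_eq w (at_level l A)].
Proof.
have single w' : part_profile (Single l) w' <-> exists a, perm_eq w' [:: (l, a)].
  have E : enum (part_vertex (Single l)) = [:: tt] by rewrite enumT unlock.
  split=> [[c _]|[a wa]]; first by rewrite E => wc; exists (c tt).
  by exists (fun=> a) => [[] []|]; rewrite // E.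
elim: m w => [|m IHm] w /=.
  rewrite listing_profile_nil; split=> [->|[A [_ /size0nil -> /perm_nilP //]]].
  by exists [::].
rewrite listing_profile_cons; split.
  move=> [w1 [w2 [ww /single[a wa] /IHm[A [uA sA wA]] cpt]]].
  have /compat_at_level := compat_perm wa wA cpt : compat (at_level l [:: a]) _.
  rewrite leqnn leqnSn => /(_ isT) aA; exists (a :: A); split.
  - rewrite /= uA andbT; apply/negP => aA'; case/hasP: aA.
    by exists a; rewrite //= mem_head.
  - by rewrite /= sA.
  - by rewrite (permPl ww) -cat1s at_level_cat perm_cat.
move=> [[|a A] [//= /andP[aA uA] [sA] wA]].
exists [:: (l, a)], (at_level l A); split=> //.
- by apply/single; exists a.
- by apply/IHm; exists A.
- apply/(@compat_at_level l l [:: a]) => _; apply/hasPn => b bA /=.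
  by rewrite inE; apply: contra aA => /eqP <-.
Qed.

Lemma count_mem_sym (A B : seq nat) :
  uniq A -> uniq B -> count (mem B) A = count (mem A) B.
Proof.
move=> uA uB; rewrite -!size_filter; apply/perm_size/uniq_perm.
- exact: filter_uniq.
- exact: filter_uniq.
- by move=> x; rewrite !mem_filter /= andbC.
Qed.

(** Once the elements common with [B] are listed first, the prefix of length [j] contains them
    all. *)
Lemma split_common (A B : seq nat) (j : nat) :
  count (mem B) A <= j -> j <= size A ->
  exists A1 A2, [/\ perm_eq A (A1 ++ A2), size A1 = j & ~~ has (mem B) A2].
Proof.
move=> cj jA; pose Z := filter (mem B) A ++ filter (predC (mem B)) A.
have pZ : perm_eq A Z by rewrite perm_sym perm_filterC.
exists (take j Z), (drop j Z); split.
- by rewrite cat_take_drop.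
- by rewrite size_takel // -(perm_size pZ).
rewrite drop_cat size_filter ltnNge cj /=.
by apply/hasPn => x /mem_drop; rewrite mem_filter => /andP[].
Qed.

Definition bicolored_profile (i r s j : nat) (w : seq (nat * nat)) : Prop :=
  exists A B, [/\ uniq A /\ size A = r, uniq B /\ size B = s, count (mem B) A <= j
    & perm_eq w (at_level i A ++ at_level i.+1 B)].

(** If [s <= r], the first [s - j] upper vertices precede the lower ones, are incomparable to them
    and share no color with them; the last [j] follow them, are comparable to all of them and may
    share any color. Conversely [split_common] puts all common colors in the last block. If [r < s],
    the lower class is split instead, and its first [j] vertices are the ones that may share
    colors. *)
Lemma replace_part_profile (i r s : nat) (H : 'I_r -> 'I_s -> bool)
    (w : seq (nat * nat)) :
  listing_profile (replace_part (Bicolored i H)) w <->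
  bicolored_profile i r s (max_common H) w.
Proof.
rewrite /=; set j := max_common H.
have := max_common_le H; rewrite leq_min -/j => /andP[jr js].
case: ifP => sr; rewrite listing_profile_cat; split.
- move=> [w1 [w2 [ww /listing_profile_single[B1 [uB1 sB1 wB1]]]]].
  move=> /listing_profile_cat[w3 [w4 [ww2 /listing_profile_single[A [uA sA wA]]]]].
  move=> /listing_profile_single[B2 [uB2 sB2 wB2]] _ c12.
  have ww2' : perm_eq w2 (at_level i A ++ at_level i.+1 B2).
    by rewrite (permPl ww2) perm_cat.
  have /compat_catr[/compat_at_level cA /compat_at_level cB] := compat_perm wB1 ww2' c12.
  have {}cA := cA _; have {}cB := cB _.
  rewrite !leqnn !leqnSn in cA cB.
  exists A, (B1 ++ B2); split=> //.
  + by rewrite cat_uniq uB1 uB2 (cB isT) size_cat sB1 sB2 subnK.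
  + rewrite -sB2 -size_filter; apply: uniq_leq_size; first exact: filter_uniq.
    move=> x; rewrite mem_filter /= mem_cat => /andP[/orP[xB1|//] xA].
    by case/hasP: (cA isT); exists x.
  + rewrite at_level_cat (permPl ww) perm_sym perm_catCA perm_sym.
    by apply: perm_cat.
- move=> [A [B [[uA sA] [uB sB] cAB wAB]]].
  have [||B2 [B1 [pB sB2 dB1]]] := @split_common B A j.
  + by rewrite count_mem_sym.
  + by rewrite sB.
  have := uB; rewrite (perm_uniq pB) cat_uniq => /and3P[uB2 dB12 uB1].
  exists (at_level i.+1 B1), (at_level i A ++ at_level i.+1 B2); split.
  + rewrite (permPl wAB) perm_sym perm_catCA perm_cat2l perm_catC -at_level_cat.
    by rewrite perm_map // perm_sym.
  + apply/listing_profile_single; exists B1; split=> //.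
    by have := perm_size pB; rewrite size_cat sB sB2; lia.
  + apply/listing_profile_cat; exists (at_level i A), (at_level i.+1 B2); split=> //.
    * by apply/listing_profile_single; exists A.
    * by apply/listing_profile_single; exists B2.
    * by apply/compat_at_level; lia.
  + apply/compat_catr; split; apply/compat_at_level => _.
      by rewrite has_sym.
    by rewrite has_sym.
- move=> [w1 [w2 [ww /listing_profile_single[A1 [uA1 sA1 wA1]]]]].
  move=> /listing_profile_cat[w3 [w4 [ww2 /listing_profile_single[B [uB sB wB]]]]].
  move=> /listing_profile_single[A2 [uA2 sA2 wA2]] c34 c12.
  have ww2' : perm_eq w2 (at_level i.+1 B ++ at_level i A2).
    by rewrite (permPl ww2) perm_cat.
  have /compat_catr[_ /compat_at_level cA] := compat_perm wA1 ww2' c12.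
  have /compat_at_level cB := compat_perm wB wA2 c34.
  rewrite !leqnn !leqnSn in cA cB.
  exists (A1 ++ A2), B; split=> //.
  + by rewrite cat_uniq uA1 uA2 (cA isT) size_cat sA1 sA2 subnKC.
  + rewrite -sA1 -size_filter; apply: uniq_leq_size.
      by rewrite filter_uniq // cat_uniq uA1 uA2 (cA isT).
    move=> x; rewrite mem_filter /= mem_cat => /andP[xB /orP[//|xA2]].
    by case/hasP: (cB isT); exists x.
  + rewrite at_level_cat (permPl ww) -catA perm_cat //.
    by rewrite (permPl ww2') perm_catC.
- move=> [A [B [[uA sA] [uB sB] cAB wAB]]].
  have [||A1 [A2 [pA sA1 dA2]]] := @split_common A B j.
  + by [].
  + by rewrite sA.
  have := uA; rewrite (perm_uniq pA) cat_uniq => /and3P[uA1 dA12 uA2].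
  exists (at_level i A1), (at_level i.+1 B ++ at_level i A2); split.
  + rewrite (permPl wAB) (permPl (perm_cat (perm_map _ pA) (perm_refl _))).
    by rewrite map_cat -catA perm_cat2l perm_catC.
  + by apply/listing_profile_single; exists A1.
  + apply/listing_profile_cat; exists (at_level i.+1 B), (at_level i A2); split=> //.
    * by apply/listing_profile_single; exists B.
    * apply/listing_profile_single; exists A2; split=> //.
      by have := perm_size pA; rewrite size_cat sA sA1; lia.
    * by apply/compat_at_level.
  + apply/compat_catr; split; apply/compat_at_level => //.
    by move=> F; exfalso; move: F; lia.
Qed.

Section Bicolored.

Context (i r s : nat) (H : 'I_r -> 'I_s -> bool).
Let p := Bicolored i H.

Lemma enum_bicolored :
  perm_eq (enum (part_vertex p))
    ([seq inl a | a <- enum 'I_r] ++ [seq inr b | b <- enum 'I_s]).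
Proof.
apply: uniq_perm; first exact: enum_uniq.
  rewrite cat_uniq (map_inj_uniq inl_inj) (map_inj_uniq inr_inj) !enum_uniq andbT /=.
  by apply/hasPn => _ /mapP[b _ ->]; apply/mapP => -[].
move=> x; rewrite mem_enum mem_cat; apply/esym/orP.
by case: x => x; [left|right]; rewrite map_f // mem_enum.
Qed.

Lemma map_enum_bicolored (c : part_vertex p -> nat) :
  perm_eq [seq (part_level v, c v) | v <- enum (part_vertex p)]
    (at_level i [seq c (inl a) | a <- enum 'I_r] ++
     at_level i.+1 [seq c (inr b) | b <- enum 'I_s]).
Proof.
apply: perm_trans (perm_map _ enum_bicolored) _.
rewrite map_cat /at_level -!(map_comp _ (fun a => inl a)).
by rewrite -!(map_comp _ (fun a => inr a)) -(map_comp (pair i))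
  -(map_comp (pair i.+1)).
Qed.

Lemma bicolored_coloringP (c : part_vertex p -> nat) :
  nat_coloring (part_incomparability p) c <->
  [/\ injective (fun a => c (inl a)), injective (fun b => c (inr b)) &
    forall a b, c (inl a) = c (inr b) -> H a b].
Proof.
split=> [pc|[injl injr cH]].
  split=> [a a' E|b b' E|a b E].
  - apply/eqP/negPn/negP => aa'; apply: (pc (inl a) (inl a')) E.
    rewrite part_incomparabilityE /part_lt /= (inj_eq (@inl_inj _ _)) aa' /=; lia.
  - apply/eqP/negPn/negP => bb'; apply: (pc (inr b) (inr b')) E.
    rewrite part_incomparabilityE /part_lt /= (inj_eq (@inr_inj _ _)) bb' /=; lia.
  - apply/negPn/negP => nH; apply: (pc (inl a) (inr b)) E.
    rewrite part_incomparabilityE /part_lt /= (negPf nH) andbF /=; lia.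
move=> [a|b] [a'|b']; rewrite part_incomparabilityE /part_lt /= => inc E.
- by move: inc; rewrite (injl _ _ E) eqxx.
- by move: inc; rewrite (cH _ _ E) eqxx.
- by move: inc; rewrite (cH _ _ (esym E)) eqxx andbF.
- by move: inc; rewrite (injr _ _ E) eqxx.
Qed.

Lemma map_nth_index (T : eqType) (X : seq nat) (Y : seq T) :
  uniq Y -> size X = size Y -> [seq nth 0 X (index y Y) | y <- Y] = X.
Proof.
move=> uY XY; case: Y uY XY => [|y Y] uY XY; first by rewrite (size0nil XY).
apply: (@eq_from_nth _ 0) => [|m]; rewrite size_map ?XY // => mY.
by rewrite (nth_map y) // index_uniq.
Qed.

(** Pairs of a lower and an upper vertex of equal color form a matching of [H], which bounds the
    number of common colors. Conversely the common colors are put on the ends of edges of a maximum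
    matching of [H], and the other colors on the remaining vertices. *)
Lemma part_profile_bicolored (w : seq (nat * nat)) :
  part_profile p w <-> bicolored_profile i r s (max_common H) w.
Proof.
split=> [[c /bicolored_coloringP[injl injr cH] wc]|].
  exists [seq c (inl a) | a <- enum 'I_r], [seq c (inr b) | b <- enum 'I_s].
  split.
  - by rewrite (map_inj_uniq injl) enum_uniq size_map size_enum_ord.
  - by rewrite (map_inj_uniq injr) enum_uniq size_map size_enum_ord.
  - pose M := [set u : 'I_r * 'I_s | c (inl u.1) == c (inr u.2)].
    apply: leq_trans (@max_common_ge r s H M _ _); last 2 first.
    + apply/forall_inP => u uM; apply/forall_inP => v vM; apply/implyP => uv.
      move: uM vM; rewrite !inE => /eqP Eu /eqP Ev.
      apply/andP; split; apply: contra uv => /eqP E; apply/eqP.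
        by apply/pair_eqP; rewrite /pair_eq E eqxx /=; apply/eqP/injr; rewrite -Eu -Ev E.
      by apply/pair_eqP; rewrite /pair_eq E eqxx andbT; apply/eqP/injl; rewrite Eu Ev E.
    + by move=> u; rewrite inE => /eqP/cH.
    rewrite cardE -(size_map (fun u => c (inl u.1))) -size_filter.
    apply: uniq_leq_size; first by rewrite filter_uniq // (map_inj_uniq injl) enum_uniq.
    move=> x; rewrite mem_filter => /andP[/mapP[b _ xb] /mapP[a _ xa]].
    apply/mapP; exists (a, b) => //; rewrite mem_enum inE /=.
    by rewrite -xa xb.
  - by rewrite (permPl wc) map_enum_bicolored.
move=> [A [B [[uA sA] [uB sB] cAB wAB]]].
have [M [mM MH sM]] := max_common_attained H.
pose q := count (mem B) A.
(* One edge of the maximum matching for each common color. *)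
pose U := take q (enum M).
have sU : size U = q by rewrite size_takel // -cardE sM.
have UM u : u \in U -> u \in M by move/mem_take; rewrite mem_enum.
have uU : uniq U by rewrite take_uniq // enum_uniq.
pose us := map fst U; pose vs := map snd U.
have Uinj u v : u \in U -> v \in U -> (u.1 == v.1) || (u.2 == v.2) -> u = v.
  move=> /UM uM /UM vM E; apply/eqP/negPn/negP => uv.
  have /forall_inP/(_ v vM)/implyP/(_ uv) := forall_inP mM u uM.
  by rewrite -negb_or E.
have uus : uniq us.
  by rewrite map_inj_in_uniq // => u v uM vM E; apply: Uinj; rewrite // E eqxx.
have uvs : uniq vs.
  by rewrite map_inj_in_uniq // => u v uM vM E; apply: Uinj; rewrite // E eqxx orbT.
pose C := filter (mem B) A.
have sC : size C = q by rewrite size_filter.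
(* Lists the vertices of a class with the ends of [U] first, and its colors with the common ones
   first; equal positions then define the coloring. *)
have complete n (vv : seq 'I_n) (X : seq nat) : uniq vv -> size vv = q -> uniq X ->
    size X = n -> {subset C <= X} -> exists Y X',
    [/\ perm_eq (enum 'I_n) (vv ++ Y), perm_eq X (C ++ X')
      & size (vv ++ Y) = size (C ++ X')].
  move=> uvv svv uX sX CX; exists (filter (predC (mem vv)) (enum 'I_n)).
  exists (filter (predC (mem C)) X).
  have E1 : perm_eq (enum 'I_n) (vv ++ filter (predC (mem vv)) (enum 'I_n)).
    apply: uniq_perm; first exact: enum_uniq.
      rewrite cat_uniq uvv filter_uniq ?enum_uniq // andbT.
      by apply/hasPn => x; rewrite mem_filter => /andP[].
    by move=> x; rewrite mem_cat [in RHS]mem_filter !mem_enum inE andbT /= orbN.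
  have E2 : perm_eq X (C ++ filter (predC (mem C)) X).
    apply: uniq_perm => //.
      rewrite cat_uniq !filter_uniq // andbT.
      by apply/hasPn => x; rewrite mem_filter => /andP[].
    move=> x; rewrite mem_cat mem_filter /=.
    by case xC: (x \in C) => //=; rewrite CX.
  split=> //.
  by rewrite -(perm_size E1) -(perm_size E2) size_enum_ord sX.
have [|||||Yu [A' [pYu pA' szA]]] := @complete r us A; rewrite ?size_map //.
  by move=> x; rewrite mem_filter => /andP[].
have [|||||Yv [B' [pYv pB' szB]]] := @complete s vs B; rewrite ?size_map //.
  by move=> x; rewrite mem_filter => /andP[].
have uYu : uniq (us ++ Yu) by rewrite -(perm_uniq pYu) enum_uniq.
have uYv : uniq (vs ++ Yv) by rewrite -(perm_uniq pYv) enum_uniq.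
have iYu a : index a (us ++ Yu) < size (C ++ A').
  by rewrite -szA index_mem -(perm_mem pYu) mem_enum.
have iYv b : index b (vs ++ Yv) < size (C ++ B').
  by rewrite -szB index_mem -(perm_mem pYv) mem_enum.
have uCA : uniq (C ++ A') by rewrite -(perm_uniq pA').
have uCB : uniq (C ++ B') by rewrite -(perm_uniq pB').
exists (fun x => match x with
  | inl a => nth 0 (C ++ A') (index a (us ++ Yu))
  | inr b => nth 0 (C ++ B') (index b (vs ++ Yv)) end).
  apply/bicolored_coloringP; split=> [a a'|b b'|a b].
  - move/eqP; rewrite nth_uniq // => /eqP/(congr1 (nth a (us ++ Yu))).
    by rewrite !nth_index // -(perm_mem pYu) mem_enum.
  - move/eqP; rewrite nth_uniq // => /eqP/(congr1 (nth b (vs ++ Yv))).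
    by rewrite !nth_index // -(perm_mem pYv) mem_enum.
  (* A color on both levels lies in [C], so [a] and [b] stand at the same position and are the two
     ends of one edge of [U]. *)
  - set x := nth _ _ _ => E.
    have xA : x \in A by rewrite (perm_mem pA') mem_nth.
    have xB : x \in B by rewrite (perm_mem pB') E mem_nth.
    have xC : x \in C by rewrite mem_filter /= xB.
    have ia : index a (us ++ Yu) = index x C.
      by rewrite -[LHS](@index_uniq _ 0 _ (C ++ A')) // -/x index_cat xC.
    have ib : index b (vs ++ Yv) = index x C.
      by rewrite -[LHS](@index_uniq _ 0 _ (C ++ B')) // -E index_cat xC.
    have xU : index x C < size U by rewrite sU -sC index_mem.
    have aE : a = (nth (a, b) U (index x C)).1.
      rewrite -[LHS](@nth_index _ a a (us ++ Yu)); last first.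
        by rewrite -(perm_mem pYu) mem_enum.
      by rewrite ia nth_cat size_map xU (nth_map (a, b)).
    have bE : b = (nth (a, b) U (index x C)).2.
      rewrite -[LHS](@nth_index _ b b (vs ++ Yv)); last first.
        by rewrite -(perm_mem pYv) mem_enum.
      by rewrite ib nth_cat size_map xU (nth_map (a, b)).
    by have := MH _ (UM _ (mem_nth (a, b) xU)); rewrite -aE -bE.
rewrite (permPl wAB) perm_sym; apply: perm_trans (map_enum_bicolored _) _.
apply: perm_cat; apply: perm_map.
  rewrite (permPr pA') -[X in perm_eq _ X](map_nth_index uYu) //.
  exact: perm_map.
rewrite (permPr pB') -[X in perm_eq _ X](map_nth_index uYv) //.
exact: perm_map.
Qed.

End Bicolored.

(** The profiles of a word are determined by those of its parts, and each replacement preserves the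
    latter, even though the posets may differ. *)
Lemma replaced_listing_profile (L : listing) (w : seq (nat * nat)) :
  listing_profile (replaced_listing L) w <-> listing_profile L w.
Proof.
have part_replaced p w' : listing_profile (replace_part p) w' <-> part_profile p w'.
  case: p => [l|i r s H]; first exact: listing_profile1.
  by rewrite replace_part_profile part_profile_bicolored.
elim: L w => [|p L IHL] w //.
rewrite listing_profile_cons [replaced_listing _]/= listing_profile_cat.
by split=> -[w1 [w2 [ww /part_replaced pw1 /IHL Lw2 cpt]]]; exists w1, w2.
Qed.

(** * Transfer of weights between graphs, and the three statements *)

Lemma is_weight_profile (k : nat) (L : listing) (a : 'I_k -> nat) :
  is_weight (listing_incomparability L) a <->
  exists w, [/\ listing_profile L w, {in w, forall x, x.2 < k}
    & forall i : 'I_k, count (fun x => x.2 == i :> nat) w = a i].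
Proof.
have sizeE (c : listing_vertex L -> nat) w i :
    perm_eq w [seq (level v, c v) | v <- enum (listing_vertex L)] ->
    count (fun x => x.2 == i :> nat) w = class_size c i.
  move=> /seq.permP ->; rewrite count_map -sum1_count big_enum_cond big_mkcond /=.
  by apply: eq_bigr => v _; case: eqP.
split=> [[c pc [ck wc]]|[w [[c pc wc] wk wa]]].
  exists [seq (level v, c v) | v <- enum (listing_vertex L)]; split.
  - by exists c.
  - by move=> _ /mapP[v _ ->]; apply: ck.
  - by move=> i; rewrite -wc; apply: sizeE.
exists c => //; split=> [v|i]; last by rewrite -(sizeE c w).
apply: (wk (level v, c v)); rewrite (perm_mem wc).
by rewrite (map_f (fun v => (level v, c v))) // mem_enum.
Qed.

Lemma is_weight_iso (k : nat) (V W : finType) (e : rel V) (e' : rel W)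
    (a : 'I_k -> nat) :
  graph_iso e e' -> is_weight e a <-> is_weight e' a.
Proof.
move=> [f [g fK gK] fe].
have size_comp (c : W -> nat) i : class_size (c \o f) i = class_size c i.
  by rewrite [RHS](reindex f) //; exists g => ? _.
split=> -[c pc [ck wc]].
  exists (c \o g) => [x y|]; first by rewrite -{1}(gK x) -{1}(gK y) fe; apply: pc.
  split=> [v|i]; first exact: ck.
  by rewrite -size_comp -wc; apply: eq_bigr => v _; rewrite /= fK.
exists (c \o f) => [x y|]; first by rewrite -fe; apply: pc.
by split=> [v|i]; [exact: ck|rewrite size_comp].
Qed.

Lemma incomparability_graph_iso (disp : Order.disp_t) (P : finPOrderType disp)
    (L : listing) :
  is_listing_of P L ->
  graph_iso (incomparability_graph P) (listing_incomparability L).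
Proof.
move=> [f bf flt]; exists f => // x y.
rewrite listing_incomparabilityE /= !flt (inj_eq (bij_inj bf)).
by rewrite /incomparability_graph /=; case: (comparableP x y).
Qed.

Lemma supp_chromatic_eq (R : realType) (k : nat) (V W : finType) (e : rel V)
    (e' : rel W) :
  (forall a : 'I_k -> nat, is_weight e a <-> is_weight e' a) ->
  supp (chromatic R e k) = supp (chromatic R e' k).
Proof.
move=> ee'; apply/seteqP.
by split=> v /supp_chromatic[a [/ee' wa ->]]; apply/supp_chromatic; exists a.
Qed.

Theorem theorem1p3 (R : realType) (k : nat) (k_gt0 : (1 <= k)%N) :
  (forall (V : finType) (e : rel V),
     ssrbool.symmetric e -> irreflexive e -> cobipartite e ->
     SNP (chromatic R e k) /\
     Newton (chromatic R e k) = permutahedron R k (lambda_cobip e)) /\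
  (forall (n : nat) (d : seq step),
     dyck_path n d ->
     SNP (chromatic R (indifference_graph n d) k) /\
     Newton (chromatic R (indifference_graph n d) k)
       = permutahedron R k (lambda_gr n d)) /\
  (forall (disp : Order.disp_t) (P : finPOrderType disp) (la : seq nat),
     three_plus_one_free P -> is_lambda_gr P la ->
     SNP (chromatic R (incomparability_graph P) k) /\
     Newton (chromatic R (incomparability_graph P) k)
       = permutahedron R k la).
Proof.
split; [|split].
- by move=> V e _; apply: permutahedral_cobipartite.
- by move=> n d _; apply: permutahedral_indifference.
move=> disp P _ _ [L [n [d [PL _ Ld ->]]]].
(* Graph isomorphisms lead from [P] to [L] and from the replaced listing to [d]; in between the
   profiles agree. The support alone determines the Newton polytope and saturation. *)
have E : supp (chromatic R (incomparability_graph P) k) =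
    supp (chromatic R (indifference_graph n d) k).
  apply: supp_chromatic_eq => a.
  rewrite (is_weight_iso a (incomparability_graph_iso PL)) -(is_weight_iso a Ld).
  rewrite !is_weight_profile.
  by split=> -[w [/replaced_listing_profile Lw wk wa]]; exists w.
rewrite /SNP /Newton E; exact: permutahedral_indifference.
Qed.
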